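(* Let $\mu_a\in\mathbb R$, $k\in\mathbb Z\setminus\{0\}$ and $$P(x)=\begin{pmatrix}-1+V(x)&-\frac kx-\mu_aV'(x)\\-\frac kx-\mu_aV'(x)&1+V(x)\end{pmatrix},\qquad x>0,$$ where $V\in C^1(0,+\infty)$ is strictly increasing and negative and satisfies: (V$_\infty$) $V(x)=\gamma_\infty x^{-\alpha_\infty}+R_{V,\infty}(x)$ with $\gamma_\infty<0$, $\alpha_\infty\in(0,1]$, $x^{\alpha_\infty}R_{V,\infty}(x)\to0$ and $x^{\alpha_\infty+1}R_{V,\infty}'(x)\to0$ as $x\to+\infty$; (V$_0$) $V(x)=\gamma_0x^{-\alpha_0}+R_{V,0}(x)$ with $\gamma_0\in\mathbb R$, $\alpha_0>0$, where: if $\mu_a=0$, then $\alpha_0=1$, $xR_{V,0}(x)\to0$ as $x\to0^+$, $\int_0^1\frac1x|xR_{V,0}(x)|^{q'}dx<+\infty$ for some $q'\ge1$, and $\gamma_0^2<k^2-\tfrac14$; if $\mu_a\ne0$, then $x^{\alpha_0}R_{V,0}(x)\to0$ and $x^{\alpha_0+1}R_{V,0}'(x)\to0$ as $x\to0^+$, $\int_0^1\frac1{x^{\alpha_0+1}}|x^{\alpha_0+1}R_{V,0}'(x)|^{q''}dx<+\infty$ for some $q''\ge1$, and $\gamma_0\ne0$. Then the self-adjoint operator $A_0$ associated with $\tau z=Jz'+P(x)z$ has a sequence of eigenvalues in $(-1,1)$ accumulating at $\lambda=1$.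
   Context: $J=\begin{pmatrix}0&1\\-1&0\end{pmatrix}$. $A_0$ is the operator $A_0z=\tau z$ with domain $D(A_0)=\{z\in L^2(0,+\infty)$ ($\mathbb R^2$-valued): $z$ locally absolutely continuous on $(0,+\infty)$, $\tau z\in L^2(0,+\infty)\}$; under these assumptions it is the unique self-adjoint realization of $\tau$. *)

(* Defs.v *)
From HB Require Import structures.
From mathcomp Require Export all_boot all_order all_algebra.
From mathcomp Require Export all_classical all_reals all_analysis.

Set Implicit Arguments.
Unset Strict Implicit.
Unset Printing Implicit Defensive.

Import Order.TTheory GRing.Theory Num.Theory.
Import numFieldNormedType.Exports.

Local Open Scope classical_set_scope.
Local Open Scope ring_scope.

Section AbsoluteContinuity.
Variable R : realType.
Implicit Types f : R -> R.

(* Interiors are required to be disjoint; intervals may share endpoints. *)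
Definition abs_continuous (a b : R) f : Prop :=
  forall e : R, 0 < e -> exists2 d : R, 0 < d &
    forall (n : nat) (l r : 'I_n -> R),
      (forall i, [/\ a <= l i, l i <= r i & r i <= b]) ->
      trivIset [set: 'I_n] (fun i => `]l i, r i[%classic) ->
      \sum_(i < n) (r i - l i) < d ->
      \sum_(i < n) `|f (r i) - f (l i)| < e.

Definition loc_abs_continuous f : Prop :=
  forall a b : R, 0 < a -> a < b -> abs_continuous a b f.

End AbsoluteContinuity.

(* Functions on (0, +oo) are represented by functions on R whose values outside
   ]0, +oo[ are never used. *)
Section DiracOperator.
Variable R : realType.
Implicit Types (P : R -> 'M[R]_2) (z : R -> 'cV[R]_2).

Definition mx22 (a b c d : R) : 'M[R]_2 :=
  \matrix_(i < 2, j < 2)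
    if i == 0 then (if j == 0 then a else b) else (if j == 0 then c else d).

Definition J : 'M[R]_2 := mx22 0 1 (-1) 0.

(* [derive1] is total and returns 0 where the derivative does not exist, which for
   a locally absolutely continuous z is a null set. *)
Definition deriv_col z (x : R) : 'cV[R]_2 :=
  \col_(i < 2) derive1 (fun t => z t i 0) x.

Definition tau P z (x : R) : 'cV[R]_2 := J *m deriv_col z x + P x *m z x.

Definition L2_pos z : Prop :=
  forall i : 'I_2,
    ((fun x => z x i 0) \_ `]0, +oo[) \in Lfun (@lebesgue_measure R) 2%:E.

Definition A0_dom P z : Prop :=
  [/\ L2_pos z,
      (forall i : 'I_2, loc_abs_continuous (fun x => z x i 0)) &
      L2_pos (tau P z)].

Definition ae_eq_pos (z w : R -> 'cV[R]_2) : Prop :=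
  {ae @lebesgue_measure R, forall x, 0 < x -> z x = w x}.

Definition A0_eigenvalue P (lambda : R) : Prop :=
  exists z, [/\ A0_dom P z, ~ ae_eq_pos z (fun=> 0) &
                ae_eq_pos (tau P z) (fun x => lambda *: z x)].

End DiracOperator.

Section Potential.
Variable R : realType.
Implicit Types (V rem : R -> R).

Definition C1_pos V : Prop :=
  forall x : R, 0 < x -> derivable V x 1 /\ {for x, continuous (derive1 V)}.

Definition dirac_P (mu_a : R) (k : int) V (x : R) : 'M[R]_2 :=
  let w := - (k%:~R / x) - mu_a * derive1 V x in
  mx22 (-1 + V x) w w (1 + V x).

Definition V_expansion V (gamma alpha : R) rem : Prop :=
  forall x : R, 0 < x -> V x = gamma * x `^ (- alpha) + rem x.

Definition cond_Vinfty V (gamma alpha : R) rem : Prop :=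
  [/\ V_expansion V gamma alpha rem,
      gamma < 0,
      0 < alpha <= 1,
      x `^ alpha * rem x @[x --> +oo] --> (0 : R) &
      x `^ (alpha + 1) * derive1 rem x @[x --> +oo] --> (0 : R)].

Definition cond_V0_mu0 (k : int) (gamma alpha : R) rem : Prop :=
  [/\ alpha = 1,
      x * rem x @[x --> 0^'+] --> (0 : R),
      (exists2 q : R, 1 <= q &
         (\int[@lebesgue_measure R]_(x in `]0%R, 1%R[)
            (x^-1 * `|x * rem x| `^ q)%:E < +oo)%E) &
      gamma ^+ 2 < (k%:~R) ^+ 2 - 4^-1].

Definition cond_V0_muN0 (gamma alpha : R) rem : Prop :=
  [/\ x `^ alpha * rem x @[x --> 0^'+] --> (0 : R),
      x `^ (alpha + 1) * derive1 rem x @[x --> 0^'+] --> (0 : R),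
      (exists2 q : R, 1 <= q &
         (\int[@lebesgue_measure R]_(x in `]0%R, 1%R[)
            ((x `^ (alpha + 1))^-1 * `|x `^ (alpha + 1) * derive1 rem x| `^ q)%:E
          < +oo)%E) &
      gamma != 0].

Definition cond_V0 (mu_a : R) (k : int) V (gamma alpha : R) rem : Prop :=
  [/\ V_expansion V gamma alpha rem,
      0 < alpha,
      (mu_a = 0 -> cond_V0_mu0 k gamma alpha rem) &
      (mu_a <> 0 -> cond_V0_muN0 gamma alpha rem)].

End Potential.

(* Main.v *)
(* Write z = (u, v) and x = e^t, and use Pruefer coordinates u = A cos theta,
   v = A sin theta. With w = -k/x - mu_a V', p = -x V > 0 and q = x w, the equation
   tau z = lambda z becomes the scalar equation
     theta' = lambda e^t + p + e^t cos (2 theta) - q sin (2 theta),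
   together with (ln A)' = q cos (2 theta) + e^t sin (2 theta).

   Near t = -oo, (V_0) makes q dominate p with a constant sign sg, so that the strip
   sg cos (2 theta) >= 0 attracts solutions forwards; near t = +oo, for lambda < 1,
   the strip m pi - pi/2 <= theta <= m pi attracts them backwards. Solving the
   boundary value problem between the two strips on an exhausting sequence of segments
   (intermediate value theorem in lambda) and extracting a limit gives an angle that
   stays in the first strip near -oo and in the second near +oo. The index m can be
   chosen for lambda in [1 - e, 1): at lambda = 1 the slow decay of V (alpha <= 1) makes
   theta rotate infinitely often, while at lambda = 1 - e it is trapped.

   In the strips the L^2 norm of z is controlled without asymptotics for A, since
   (sg (u^2 - v^2))' >= 2 (u^2 + v^2) near 0 and (u v)' >= c (u^2 + v^2) near +oo (in
   the variable x), where sg (u^2 - v^2) >= 0 and u v <= 0, respectively. *)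
Require Import Defs.
From mathcomp Require Import measurable_realfun ring lra.

Set Implicit Arguments.
Unset Strict Implicit.
Unset Printing Implicit Defensive.

Import Order.TTheory GRing.Theory Num.Theory.
Import numFieldNormedType.Exports.
Local Open Scope classical_set_scope.
Local Open Scope ring_scope.

(** * Real calculus *)

Section PointwiseDerivatives.
Variable R : realType.
Implicit Types (f g : R -> R) (x df dg : R).

Lemma is_derive_continuous f x df : is_derive x 1 f df ->
  @continuous_at R R x f.
Proof. by case=> fx _; exact/differentiable_continuous/derivable1_diffP. Qed.

Lemma is_derive_addf f g x df dg : is_derive x 1 f df -> is_derive x 1 g dg ->
  is_derive x 1 (fun t => f t + g t) (df + dg).
Proof. by move=> ? ?; exact: is_deriveD. Qed.

Lemma is_derive_subf f g x df dg : is_derive x 1 f df -> is_derive x 1 g dg ->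
  is_derive x 1 (fun t => f t - g t) (df - dg).
Proof. by move=> ? ?; exact: is_deriveB. Qed.

Lemma is_derive_oppf f x df : is_derive x 1 f df ->
  is_derive x 1 (fun t => - f t) (- df).
Proof. by move=> ?; exact: is_deriveN. Qed.

Lemma is_derive_mulf f g x df dg : is_derive x 1 f df -> is_derive x 1 g dg ->
  is_derive x 1 (fun t => f t * g t) (f x * dg + g x * df).
Proof. by move=> ? ?; exact: is_deriveM. Qed.

Lemma is_derive_compf f g x df dg : is_derive (g x) 1 f df ->
  is_derive x 1 g dg -> is_derive x 1 (fun t => f (g t)) (df * dg).
Proof. by move=> ? ?; exact: is_derive1_comp. Qed.

Lemma is_derive_scalef f x c df : is_derive x 1 f df ->
  is_derive x 1 (fun t => c * f t) (c * df).
Proof. by move=> ?; exact: is_deriveZ. Qed.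

Lemma is_derive_expRf f x df : is_derive x 1 f df ->
  is_derive x 1 (fun t => expR (f t)) (expR (f x) * df).
Proof. by move=> ?; exact: is_derive_compf. Qed.

Lemma is_derive_cosf f x df : is_derive x 1 f df ->
  is_derive x 1 (fun t => cos (f t)) (- sin (f x) * df).
Proof. by move=> ?; exact: is_derive_compf. Qed.

Lemma is_derive_sinf f x df : is_derive x 1 f df ->
  is_derive x 1 (fun t => sin (f t)) (cos (f x) * df).
Proof. by move=> ?; exact: is_derive_compf. Qed.

Lemma is_derive_idf x : is_derive x 1 (fun t : R => t) (1 : R).
Proof. exact: is_derive_id. Qed.

Lemma is_derive_cstf (c x : R) : is_derive x 1 (fun _ : R => c) (0 : R).
Proof. exact: is_derive_cst. Qed.

Lemma continuous_addf f g x : @continuous_at R R x f -> @continuous_at R R x g ->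
  @continuous_at R R x (fun t => f t + g t).
Proof. exact: continuousD. Qed.

Lemma continuous_subf f g x : @continuous_at R R x f -> @continuous_at R R x g ->
  @continuous_at R R x (fun t => f t - g t).
Proof. exact: continuousB. Qed.

Lemma continuous_oppf f x : @continuous_at R R x f ->
  @continuous_at R R x (fun t => - f t).
Proof. exact: continuousN. Qed.

Lemma continuous_mulf f g x : @continuous_at R R x f -> @continuous_at R R x g ->
  @continuous_at R R x (fun t => f t * g t).
Proof. exact: continuousM. Qed.

Lemma continuous_scalef f x (c : R) : @continuous_at R R x f ->
  @continuous_at R R x (fun t => c * f t).
Proof. by apply: continuous_mulf; exact: cvg_cst. Qed.

Lemma continuous_compf f g x : @continuous_at R R (g x) f -> @continuous_at R R x g ->
  @continuous_at R R x (fun t => f (g t)).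
Proof. by move=> ? ?; exact: continuous_comp. Qed.

End PointwiseDerivatives.

Section RealCalculus.
Variable R : realType.
Implicit Types (f g F : R -> R) (a b c x y : R).

Lemma derive_ge0_le F F' a b : a <= b ->
  (forall x, a <= x <= b -> is_derive x 1 F (F' x)) ->
  (forall x, a <= x <= b -> 0 <= F' x) -> F a <= F b.
Proof.
move=> ab dF F'0.
have [x | | c /[!in_itv]/= cab E] := @MVT_segment _ F F' a b ab.
- by rewrite in_itv/= => /andP[/ltW ax /ltW xb]; apply: dF; rewrite ax xb.
- apply: derivable_within_continuous => x; rewrite in_itv/= => xab.
  by case: (dF _ xab).
- by rewrite -subr_ge0 E mulr_ge0 ?subr_ge0 ?F'0.
Qed.

Lemma derive_le_incr F F' g g' a b : a <= b ->
  (forall x, a <= x <= b -> is_derive x 1 F (F' x)) ->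
  (forall x, a <= x <= b -> is_derive x 1 g (g' x)) ->
  (forall x, a <= x <= b -> F' x <= g' x) -> F b - F a <= g b - g a.
Proof.
move=> ab dF dg le.
have : g a - F a <= g b - F b.
  apply: (@derive_ge0_le (fun x => g x - F x) (fun x => g' x - F' x)) => // x xab.
    by apply: is_derive_subf; [exact: dg | exact: dF].
  by rewrite subr_ge0 le.
lra.
Qed.

Lemma derive_norm_le_incr F F' g g' a b : a <= b ->
  (forall x, a <= x <= b -> is_derive x 1 F (F' x)) ->
  (forall x, a <= x <= b -> is_derive x 1 g (g' x)) ->
  (forall x, a <= x <= b -> `|F' x| <= g' x) -> `|F b - F a| <= g b - g a.
Proof.
move=> ab dF dg le; rewrite ler_norml; apply/andP; split; last first.
  by apply: (derive_le_incr ab dF dg) => x /le /ler_normlW.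
have := @derive_le_incr (fun x => - F x) (fun x => - F' x) g g' a b ab.
move=> /(_ (fun x xab => is_derive_oppf (dF x xab)) dg).
have le' x : a <= x <= b -> - F' x <= g' x by move=> /le /lerNnormlW; lra.
by move=> /(_ le'); lra.
Qed.

Lemma derive_norm_le1 F F' : (forall x, is_derive x 1 F (F' x)) ->
  (forall x, `|F' x| <= 1) -> forall x y, `|F x - F y| <= `|x - y|.
Proof.
move=> dF F'1; have H x y : x <= y -> `|F y - F x| <= y - x.
  move=> xy; apply: (@derive_norm_le_incr F F' idfun (fun _ => 1)) => // z _;
  exact: is_derive_idf || exact: F'1.
move=> x y; case: (leP x y) => [xy|/ltW yx].
  by rewrite distrC [leRHS]distrC (ger0_norm (_ : 0 <= y - x)) ?subr_ge0// H.
by rewrite (ger0_norm (_ : 0 <= x - y)) ?subr_ge0// H.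
Qed.

Lemma cos_lipschitz1 x y : `|cos x - cos y| <= `|x - y|.
Proof.
by apply: (@derive_norm_le1 cos (fun z => - sin z)) => z; rewrite normrN sin_max.
Qed.

Lemma sin_lipschitz1 x y : `|sin x - sin y| <= `|x - y|.
Proof. by apply: (@derive_norm_le1 sin cos) => z; rewrite cos_max. Qed.

Lemma derive0_eq F a b : a <= b ->
  (forall x, a <= x <= b -> is_derive x 1 F 0) -> F a = F b.
Proof.
move=> ab dF; apply/eqP; rewrite eq_sym -subr_eq0 -normr_le0.
rewrite -[leRHS](subrr (0 : R)).
by apply: (@derive_norm_le_incr F (fun=> 0) (fun=> 0) (fun=> 0)) => // x _;
  exact: is_derive_cstf || rewrite normr0.
Qed.

Lemma antiderivative_ray f c : continuous f ->
  exists F, forall x, c < x -> is_derive x 1 F (f x).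
Proof.
move=> cf.
exists (fun x => \int[@lebesgue_measure R]_(t in `[c, x]) f t)%R => x cx.
have xu : x < x + 1 by rewrite ltrDl.
have intf : (@lebesgue_measure R).-integrable `[c, x + 1] (EFin \o f).
  apply: continuous_compact_integrable; first exact: segment_compact.
  exact: continuous_subspaceT.
have [d D] := continuous_FTC1_closed xu intf cx (cf x).
apply: DeriveDef; first exact: d.
by rewrite -derive1E; exact: D.
Qed.

Lemma antiderivative f : continuous f ->
  exists F, forall x, is_derive x 1 F (f x).
Proof.
move=> cf.
have /choice[G dG] : forall n : nat, exists F,
    (forall x, - n%:R - 1 < x -> is_derive x 1 F (f x)) /\ F 0 = 0.
  move=> n; have [F dF] := antiderivative_ray (- n%:R - 1) cf.
  exists (fun x => F x - F 0); split => [x nx|]; last by rewrite subrr.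
  apply: is_derive_eq; last exact: subr0.
  by apply: is_derive_subf; exact: dF.
have GE m n x : - m%:R - 1 < x -> - n%:R - 1 < x -> G m x = G n x.
  move=> mx nx; apply/eqP; rewrite -subr_eq0; apply/eqP.
  have n0 k : - k%:R - 1 < 0 :> R by have := ler0n R k; lra.
  have D y : - m%:R - 1 < y -> - n%:R - 1 < y ->
      is_derive y 1 (fun x => G m x - G n x) 0.
    move=> my ny; apply: is_derive_eq; last exact: (subrr (f y)).
    by apply: is_derive_subf; apply: (proj1 (dG _)).
  have E : G m 0 - G n 0 = 0 by rewrite !(proj2 (dG _)) subrr.
  case: (leP 0 x) => [x0|/ltW x0]; rewrite -E; [symmetry|];
    apply: (@derive0_eq (fun x => G m x - G n x)) => // y /andP[y1 y2];
    by apply: D; [have := n0 m | have := n0 n]; lra.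
have tr x : - (Num.truncn `|x|)%:R - 1 < x.
  have := truncnS_gt `|x|; rewrite -natr1.
  have := lerNnormlW (lexx `|x|); lra.
exists (fun x => G (Num.truncn `|x|) x) => x.
have [n nx] : exists n : nat, - n%:R < x.
  by exists (Num.truncn `|x|).+1; rewrite -natr1 opprD.
apply: (@near_eq_is_derive _ _ _ (G n)).
  near=> y; apply: GE; last exact: tr.
  suff : - n%:R < y by lra.
  by near: y; exact: lt_nbhsr.
by apply: (proj1 (dG _)); lra.
Unshelve. all: by end_near. Qed.

End RealCalculus.

(** * Global solutions of ordinary differential equations *)

Section OrdinaryDifferentialEquation.
Variable R : realType.
Implicit Types (y D N Lam : R -> R) (s t x c W : R).

Lemma le0_geometric (x C : R) : (forall n, x <= C * 2^-1 ^+ n) -> x <= 0.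
Proof.
move=> H; rewrite leNgt; apply/negP => x0.
have C0 : 0 < C by have := H 0%N; rewrite expr0 mulr1; apply: lt_le_trans.
have /archi_boundP Cn : 0 <= C / x by rewrite divr_ge0// ltW.
set n := Num.bound _ in Cn; have := H n; rewrite leNgt => /negP; apply.
rewrite exprVn ltr_pdivrMr ?exprn_gt0//; move: Cn; rewrite ltr_pdivrMr// => Cn.
apply: (lt_le_trans Cn); rewrite mulrC ler_pM2l//.
by rewrite -natrX ler_nat ltnW// ltn_expl.
Qed.

Lemma geometric_cauchy (u : nat -> R) W :
  (forall n, `|u n.+1 - u n| <= W * 2^-1 ^+ n) ->
  exists l, forall n, `|u n - l| <= 2 * W * 2^-1 ^+ n.
Proof.
move=> H; pose a n := u n - 2 * W * 2^-1 ^+ n; pose b n := u n + 2 * W * 2^-1 ^+ n.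
have aS : {homo a : m n / (m <= n)%N >-> m <= n}.
  apply/nondecreasing_seqP => n.
  by rewrite /a exprS; have := lerNnormlW (H n); lra.
have bS : {homo b : m n / (m <= n)%N >-> n <= m}.
  apply/nonincreasing_seqP => n.
  by rewrite /b exprS; have := ler_normlW (H n); lra.
have W0 n : 0 <= W * 2^-1 ^+ n by exact: le_trans (normr_ge0 _) (H n).
have ab m n : a m <= b n.
  apply: (le_trans (aS _ _ (leq_maxl m n))).
  apply: (le_trans _ (bS _ _ (leq_maxr m n))).
  by rewrite /a /b; have := W0 (maxn m n); lra.
exists (sup (range a)) => n; rewrite ler_distl; apply/andP; split.
  suff : sup (range a) <= b n by rewrite /b; lra.
  by apply: ge_sup; [exists (a 0%N), 0%N | move=> _ [m _ <-]].
suff : a n <= sup (range a) by rewrite /a; lra.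
apply: ub_le_sup; last by exists n.
by exists (b 0%N) => _ [m _ <-].
Qed.

Lemma compare_exp D D' Lam ell c t0 t : 0 <= c -> Lam t0 = 0 ->
  (forall s, 0 <= ell s) ->
  (forall s, is_derive s 1 Lam (ell s)) -> (forall s, is_derive s 1 D (D' s)) ->
  (forall s, `|D' s| <= c * ell s * expR (2 * `|Lam s|)) ->
  `|D t - D t0| <= c / 2 * expR (2 * `|Lam t|).
Proof.
move=> c0 Lam0 ell0 dLam dD bD.
have Lam_le a b : a <= b -> Lam a <= Lam b.
  by move=> ab; apply: (@derive_ge0_le _ Lam ell).
have dexp k s : is_derive s 1 (fun s => expR (k * Lam s))
    (expR (k * Lam s) * (k * ell s)).
  by apply: is_derive_expRf; exact: is_derive_scalef.
have dkexp h k s : is_derive s 1 (fun s => h * expR (k * Lam s))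
    (h * k * ell s * expR (k * Lam s)).
  by apply: (is_derive_eq (is_derive_scalef h (dexp k s))); ring.
case: (leP t0 t) => [tt|/ltW tt].
  apply: (le_trans (derive_norm_le_incr tt (fun s _ => dD s)
    (fun s _ => dkexp (c / 2) 2 s) _)) => [s /andP[s1 _]|].
    apply: (le_trans (bD s)).
    rewrite (ger0_norm (_ : 0 <= Lam s)) -?Lam0 ?Lam_le//.
    by rewrite (_ : c / 2 * 2 = c)//; field.
  rewrite Lam0 mulr0 expR0 (ger0_norm (_ : 0 <= Lam t)) -?Lam0 ?Lam_le//; lra.
rewrite distrC; apply: (le_trans (derive_norm_le_incr tt (fun s _ => dD s)
  (fun s _ => dkexp (- (c / 2)) (- 2) s) _)) => [s /andP[_ s1]|].
  apply: (le_trans (bD s)).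
  rewrite (ler0_norm (_ : Lam s <= 0)) -?Lam0 ?Lam_le//.
  by rewrite (_ : - (c / 2) * - 2 = c) ?(mulrN 2) ?(mulNr 2)//; field.
rewrite Lam0 mulr0 expR0 (ler0_norm (_ : Lam t <= 0)) -?Lam0 ?Lam_le//.
by rewrite (mulrN 2) (mulNr 2); lra.
Qed.

Lemma gronwall N N' Lam ell t0 t : (forall s, 0 <= N s) ->
  (forall s, is_derive s 1 Lam (ell s)) -> (forall s, is_derive s 1 N (N' s)) ->
  (forall s, `|N' s| <= ell s * N s) ->
  N t <= N t0 * expR `|Lam t - Lam t0|.
Proof.
move=> N0 dLam dN bN.
have dexp k s : is_derive s 1 (fun s => N s * expR (k * Lam s))
    ((N' s + k * (ell s * N s)) * expR (k * Lam s)).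
  apply: (is_derive_eq (is_derive_mulf (dN s)
    (is_derive_expRf (is_derive_scalef k (dLam s))))).
  by ring.
case: (leP t0 t) => [tt|/ltW tt].
  have H := @derive_le_incr _ _ _ (fun=> 0) (fun=> 0) _ _ tt
    (fun s _ => dexp (- 1) s) (fun s _ => is_derive_cstf 0 s).
  have {H} : N t * expR (- Lam t) <= N t0 * expR (- Lam t0).
    rewrite -subr_le0 -!(mulN1r (Lam _)) -[leRHS](subrr (0 : R)).
    apply: H => s _; rewrite pmulr_lle0 ?expR_gt0//.
    by have := ler_normlW (bN s); lra.
  move=> H; apply: (@le_trans _ _ (N t0 * expR (Lam t - Lam t0))).
    rewrite -(ler_pM2r (expR_gt0 (- Lam t))) -mulrA -expRD.
    by rewrite (_ : Lam t - Lam t0 - Lam t = - Lam t0)//; ring.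
  by rewrite ler_wpM2l// ler_expR ler_norm.
have H := @derive_ge0_le _ _ _ _ _ tt (fun s _ => dexp 1 s).
have {H} : N t * expR (Lam t) <= N t0 * expR (Lam t0).
  rewrite -[Lam t]mul1r -[Lam t0]mul1r; apply: H => s _; rewrite pmulr_lge0 ?expR_gt0//.
  by have := lerNnormlW (bN s); lra.
move=> H; apply: (@le_trans _ _ (N t0 * expR (Lam t0 - Lam t))).
  rewrite -(ler_pM2r (expR_gt0 (Lam t))) -mulrA -expRD.
  by rewrite (_ : Lam t0 - Lam t + Lam t = Lam t0)//; ring.
by rewrite ler_wpM2l// ler_expR distrC ler_norm.
Qed.

Lemma continuous_of_dominated y Lam : continuous Lam ->
  (forall s t, `|y s - y t| <= `|Lam s - Lam t|) -> continuous y.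
Proof.
move=> cLam yLam t; apply/cvgrPdist_lt => e e0.
have /cvgrPdist_lt /(_ e e0) := cLam t.
by apply: filterS => s; exact: le_lt_trans.
Qed.

Theorem ode_global_existence (F : R -> R -> R) (ell : R -> R) (t0 phi : R) :
  continuous ell ->
  (forall y, continuous y -> continuous (fun t => F t (y t))) ->
  (forall t x, `|F t x| <= ell t) ->
  (forall t x x', `|F t x - F t x'| <= ell t * `|x - x'|) ->
  exists y, y t0 = phi /\ forall t, is_derive t 1 y (F t (y t)).
Proof.
move=> cell cF bF lF.
have ell0 s : 0 <= ell s by exact: le_trans (bF s 0).
have prim : forall f : R -> R, exists G : R -> R,
    continuous f -> G t0 = 0 /\ forall x, is_derive x 1 G (f x).
  move=> f; have [cf|] := pselect (continuous f); last by exists f.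
  have [G dG] := antiderivative cf.
  exists (fun x => G x - G t0) => _; split; first by rewrite subrr.
  move=> x.
  exact: (is_derive_eq (is_derive_subf (dG x) (is_derive_cstf _ x)) (subr0 _)).
have /choice[A AP] := prim.
have [Lam0 dLam] := AP _ cell; set Lam := A ell in Lam0 dLam.
have cLam : continuous Lam by move=> s; exact: (is_derive_continuous (dLam s)).
pose T y := fun t => phi + A (fun s => F s (y s)) t.
have dT y : continuous y -> forall t, is_derive t 1 (T y) (F t (y t)).
  move=> cy t; have D := (AP _ (cF _ cy)).2 t.
  exact: (is_derive_eq (is_derive_addf (is_derive_cstf phi t) D) (add0r _)).
have T0 y : continuous y -> T y t0 = phi.
  by move=> cy; rewrite /T (AP _ (cF _ cy)).1 addr0.
have T_Lam y s t : continuous y -> `|T y s - T y t| <= `|Lam s - Lam t|.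
  move=> cy; wlog st : s t / t <= s.
    by move=> H; case: (leP t s) => [/H//|/ltW /H]; rewrite distrC [leRHS]distrC.
  apply: (le_trans _ (ler_norm _)).
  apply: (derive_norm_le_incr st (fun z _ => dT y cy z) (fun z _ => dLam z)) => z _.
  exact: bF.
have cT y : continuous y -> continuous (T y).
  by move=> cy; apply: (continuous_of_dominated cLam) => s t; exact: T_Lam.
have compare y1 y2 c : 0 <= c -> continuous y1 -> continuous y2 ->
    (forall s, `|y1 s - y2 s| <= c * expR (2 * `|Lam s|)) ->
    forall s, `|T y1 s - T y2 s| <= c / 2 * expR (2 * `|Lam s|).
  move=> c0 c1 c2 le s.
  have E : T y1 t0 - T y2 t0 = 0 by rewrite !T0// subrr.
  rewrite -[_ - T y2 s]subr0 -{}E.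
  apply: (@compare_exp (fun s => T y1 s - T y2 s) _ Lam ell) => //.
    by move=> z; apply: is_derive_subf; exact: dT.
  move=> z; apply: (le_trans (lF _ _ _)).
  by rewrite (mulrC c) -mulrA ler_wpM2l.
pose Y n := iter n T (fun=> phi).
have cY n : continuous (Y n).
  by elim: n => [|n IH]; [move=> ?; exact: cvg_cst | exact: cT].
have W1 s : 1 <= expR (2 * `|Lam s|) by rewrite -expR0 ler_expR mulr_ge0.
have YS n s : `|Y n.+1 s - Y n s| <= expR (2 * `|Lam s|) * 2^-1 ^+ n.
  elim: n s => [|n IH] s.
    rewrite expr0 mulr1 /= -{2}(T0 (fun=> phi) (cY 0%N)).
    apply: le_trans (_ : 1 / 2 * expR (2 * `|Lam s|) <= _).
      apply: (@compare_exp _ _ Lam ell 1 _ _ _ _ _ dLam (dT _ (cY 0%N))) => //.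
      move=> z; apply: (le_trans (bF _ _)).
      by rewrite mul1r ler_peMr.
    by have := W1 s; lra.
  rewrite exprSr mulrC; apply: (compare _ _ _ _ (cY n.+1) (cY n)) => // z.
  by rewrite mulrC; exact: IH.
have /choice[y yP] : forall s, exists l,
    forall n, `|Y n s - l| <= 2 * expR (2 * `|Lam s|) * 2^-1 ^+ n.
  by move=> s; apply: geometric_cauchy => n; exact: YS.
have cy : continuous y.
  apply: (continuous_of_dominated cLam) => s t; rewrite -subr_le0.
  apply: (@le0_geometric _ (expR (2 * `|Lam s|) + expR (2 * `|Lam t|))) => n.
  have := T_Lam (Y n) s t (cY n); have := yP s n.+1; have := yP t n.+1.
  rewrite exprS /= -/(Y n); set a := 2^-1 ^+ n; set u := T (Y n).
  have := ler_distD (u s) (y s) (y t); have := ler_distD (u t) (u s) (y t).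
  rewrite (distrC (y s) (u s)).
  by lra.
exists y.
have yT : y = T y.
  apply/funext => s; apply/eqP; rewrite -subr_eq0 -normr_le0.
  apply: (@le0_geometric _ (2 * expR (2 * `|Lam s|))) => n.
  have H : `|T (Y n) s - T y s| <= 2 * 2^-1 ^+ n / 2 * expR (2 * `|Lam s|).
    apply: (compare _ _ _ _ (cY n) cy) => [|z]; first by rewrite mulr_ge0.
    by rewrite mulrAC; exact: yP.
  have := yP s n.+1; have := ler_distD (T (Y n) s) (y s) (T y s).
  rewrite (distrC (y s) (T (Y n) s)).
  by rewrite /= -/(Y n) exprS; lra.
split; first by rewrite yT T0.
by move=> t; rewrite {1}yT; exact: dT.
Qed.

End OrdinaryDifferentialEquation.

(** * The Pruefer equation *)

Section Barriers.
Variable R : realType.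
Implicit Types (f : R -> R) (a b c t : R).

Lemma barrier_below f f' a b c : a <= b ->
  (forall t, is_derive t 1 f (f' t)) -> continuous f' ->
  (forall t, a <= t <= b -> f t = c -> 0 < f' t) ->
  c <= f a -> c <= f b.
Proof.
move=> ab df cf' pos fa; rewrite leNgt; apply/negP => fb.
have cf : continuous f by move=> t; exact: (is_derive_continuous (df t)).
pose S := [set t | a <= t <= b /\ c <= f t].
have Sa : S a by split => //; rewrite lexx.
have supS : has_sup S by split; [exists a | exists b => t [/andP[]]].
pose s := sup S.
have sS t : S t -> t <= s by move=> St; exact: (ub_le_sup supS.2).
have as_ : a <= s by exact: sS.
have sb : s <= b by apply: ge_sup; [exists a | move=> t [/andP[]]].
have fs : c <= f s.
  rewrite leNgt; apply/negP => fsc.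
  have /nbhs_ballP[d /= d0 H] : \forall t \near s, f t < c.
    exact: (cvgr_lt _ (cf s)).
  have [t St st] := sup_adherent d0 supS.
  have : f t < c.
    apply: H; rewrite /ball/= ger0_norm ?subr_ge0 ?sS//.
    by rewrite -/s in st; lra.
  by rewrite ltNge St.2.
have {sb}sb : s < b.
  by rewrite lt_neqAle sb andbT; apply: contraTneq fb => <-; rewrite -leNgt.
have [d d0 H] : exists2 d, 0 < d & forall t, s <= t < s + d -> c <= f t.
  move: fs; rewrite le_eqVlt => /predU1P[fs|fs].
    have /nbhs_ballP[d /= d0 H] : \forall t \near s, 0 < f' t.
      by apply: (cvgr_gt _ (cf' s)); apply: pos; rewrite ?as_ ?ltW.
    exists d => // t /andP[st td]; rewrite fs.
    apply: (@derive_ge0_le _ f f') => // x /andP[sx xt].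
    by apply/ltW/H; rewrite /ball/= ltr_distlC; apply/andP; split; lra.
  have /nbhs_ballP[d /= d0 H] : \forall t \near s, c < f t.
    exact: (cvgr_gt _ (cf s)).
  exists d => // t /andP[st td].
  by apply/ltW/H; rewrite /ball/= ltr_distlC; apply/andP; split; lra.
pose t := Num.min b (s + d / 2).
have st : s < t by rewrite lt_min sb/=; lra.
have td : t < s + d by rewrite gt_min; apply/orP; right; lra.
have : t <= s.
  apply: sS; split; last by apply: H; rewrite (ltW st).
  by rewrite ge_min lexx (le_trans as_ (ltW st)).
by rewrite leNgt st.
Qed.

Lemma barrier_above f f' a b c : a <= b ->
  (forall t, is_derive t 1 f (f' t)) -> continuous f' ->
  (forall t, a <= t <= b -> f t = c -> f' t < 0) ->
  f a <= c -> f b <= c.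
Proof.
move=> ab df cf' neg fa; rewrite -lerN2.
apply: (@barrier_below (fun t => - f t) (fun t => - f' t) a) => //.
- by move=> t; apply: continuousN; exact: cf'.
- by move=> t tab /oppr_inj ft; rewrite oppr_gt0 neg.
- by rewrite lerN2.
Qed.

End Barriers.

Section PrueferEquation.
Variable R : realType.
Variables p q : R -> R.
Hypotheses (cp : continuous p) (cq : continuous q) (p_gt0 : forall t, 0 < p t).
Implicit Types (lambda s t x : R) (y theta : R -> R).

Definition pruefer lambda t x :=
  lambda * expR t + p t + expR t * cos (2 * x) - q t * sin (2 * x).

Definition pruefer_solution lambda theta :=
  forall t, is_derive t 1 theta (pruefer lambda t (theta t)).

Definition pruefer_rate t := 5 * expR t + 4 * `|q t| + p t.

Lemma continuous_pruefer_rate : continuous pruefer_rate.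
Proof.
move=> t; rewrite /pruefer_rate; apply: continuous_addf; last exact: cp.
apply: continuous_addf; apply: continuous_scalef; first exact: continuous_expR.
apply: (@continuous_compf _ (fun x => `|x|)); last exact: cq.
exact: norm_continuous.
Qed.

Lemma continuous_pruefer lambda y : continuous y ->
  continuous (fun t => pruefer lambda t (y t)).
Proof.
move=> cy t; have c2 := continuous_scalef (c := 2) (cy t); rewrite /pruefer.
apply: continuous_subf; last first.
  apply: continuous_mulf; first exact: cq.
  exact: (continuous_compf (@continuous_sin _ _) c2).
apply: continuous_addf; last first.
  apply: continuous_mulf; first exact: continuous_expR.
  exact: (continuous_compf (@continuous_cos _ _) c2).
apply: continuous_addf; last exact: cp.
by apply: continuous_mulf; [exact: cvg_cst | exact: continuous_expR].
Qed.

Lemma pruefer_solution_continuous lambda theta :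
  pruefer_solution lambda theta -> continuous theta.
Proof. by move=> H t; exact: (is_derive_continuous (H t)). Qed.

Lemma pruefer_le_rate lambda t x : `|lambda| <= 1 ->
  `|pruefer lambda t x| <= pruefer_rate t.
Proof.
move=> l1; rewrite /pruefer /pruefer_rate.
have r0 := expR_gt0 t; have p0 := p_gt0 t.
have h1 : `|lambda * expR t| <= expR t.
  by rewrite normrM (gtr0_norm r0) ler_piMl// ltW.
have h2 : `|expR t * cos (2 * x)| <= expR t.
  by rewrite normrM (gtr0_norm r0) ler_piMr ?cos_max// ltW.
have h3 : `|q t * sin (2 * x)| <= `|q t|.
  by rewrite normrM ler_piMr ?sin_max.
have q0 := normr_ge0 (q t).
apply: (le_trans (ler_normB _ _)); apply: (le_trans (lerD (ler_normD _ _) h3)).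
apply: (le_trans (lerD (lerD (ler_normD _ _) h2) (lexx _))).
by rewrite (gtr0_norm p0); lra.
Qed.

Lemma pruefer_lipschitz lambda lambda' t x x' :
  `|pruefer lambda t x - pruefer lambda' t x'| <=
  expR t * `|lambda - lambda'| + 2 * (expR t + `|q t|) * `|x - x'|.
Proof.
have r0 := expR_gt0 t.
rewrite (_ : _ - _ = (expR t * (lambda - lambda') +
  expR t * (cos (2 * x) - cos (2 * x'))) - q t * (sin (2 * x) - sin (2 * x')));
  last by rewrite /pruefer; ring.
have d2 : `|2 * x - 2 * x'| = 2 * `|x - x'| by rewrite -mulrBr normrM ger0_norm.
apply: (le_trans (ler_normB _ _)); apply: (le_trans (lerD (ler_normD _ _) (lexx _))).
rewrite !normrM (gtr0_norm r0) -addrA lerD2l mulrDr mulrDl.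
rewrite (mulrC 2 (expR t)) (mulrC 2 `|q t|) -!mulrA -d2.
apply: lerD; first by rewrite ler_wpM2l ?cos_lipschitz1// ltW.
by rewrite ler_wpM2l ?sin_lipschitz1.
Qed.

Lemma pruefer_solution_exists lambda t0 phi :
  exists theta, theta t0 = phi /\ pruefer_solution lambda theta.
Proof.
pose ell t := pruefer_rate t + `|lambda| * expR t.
have cell : continuous ell.
  move=> t; rewrite /ell; apply: continuous_addf; first exact: continuous_pruefer_rate.
  exact: (continuous_scalef (@continuous_expR _ t)).
apply: (@ode_global_existence _ (pruefer lambda) ell) => //.
- exact: continuous_pruefer.
- move=> t x; have r0 := expR_gt0 t.
  rewrite (_ : pruefer lambda t x = pruefer 0 t x + lambda * expR t); last first.
    by rewrite /pruefer; ring.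
  apply: (le_trans (ler_normD _ _)); rewrite normrM (gtr0_norm r0) lerD2r.
  by apply: pruefer_le_rate; rewrite normr0.
- move=> t x x'; apply: (le_trans (pruefer_lipschitz _ _ _ _ _)).
  rewrite subrr normr0 mulr0 add0r ler_wpM2r// /ell /pruefer_rate.
  have r0 := expR_gt0 t; have := p_gt0 t; have := normr_ge0 (q t).
  have : 0 <= `|lambda| * expR t by rewrite mulr_ge0// ltW.
  by lra.
Qed.

Lemma pruefer_dependence t0 t : exists2 K, 0 <= K &
  forall lambda1 lambda2 theta1 theta2,
    pruefer_solution lambda1 theta1 -> pruefer_solution lambda2 theta2 ->
    `|theta1 t - theta2 t| <=
    K * (`|theta1 t0 - theta2 t0| + `|lambda1 - lambda2|).
Proof.
have [Lam dLam] := antiderivative continuous_pruefer_rate.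
set K := expR `|Lam t - Lam t0|; exists K; first exact: expR_ge0.
move=> l1 l2 th1 th2 s1 s2; pose D s := th1 s - th2 s.
have dD s : is_derive s 1 D (pruefer l1 s (th1 s) - pruefer l2 s (th2 s)).
  exact: is_derive_subf.
have dN s := is_derive_addf (is_derive_mulf (dD s) (dD s))
  (is_derive_cstf (`|l1 - l2| ^+ 2) s).
have K1 : 1 <= K by rewrite -expR0 ler_expR.
have : D t * D t + `|l1 - l2| ^+ 2 <=
    (D t0 * D t0 + `|l1 - l2| ^+ 2) * K.
  apply: (gronwall t0 t _ dLam dN) => s; first by rewrite -expr2 addr_ge0 ?sqr_ge0.
  rewrite addr0 -mulr2n -mulr_natl normrM ger0_norm// normrM.
  have r0 := expR_gt0 s; have p0 := p_gt0 s; have q0 := normr_ge0 (q s).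
  have := pruefer_lipschitz l1 l2 s (th1 s) (th2 s).
  rewrite -/(D s); set E := `|_ - pruefer _ _ _| => HE.
  have -> : D s * D s = `|D s| * `|D s|.
    by rewrite -normrM ger0_norm// -expr2 sqr_ge0.
  rewrite /pruefer_rate.
  set d := `|D s| in HE *; set l := `|l1 - l2| in HE *.
  have d0 : 0 <= d by exact: normr_ge0.
  have l0 : 0 <= l by exact: normr_ge0.
  apply: (@le_trans _ _ (2 * (d * (expR s * l + 2 * (expR s + `|q s|) * d)))).
    by rewrite ler_pM2l// ler_wpM2l.
  have h1 : 0 <= expR s * (d - l) ^+ 2 by rewrite mulr_ge0 ?sqr_ge0// ltW.
  have h2 : 0 <= p s * (d * d + l ^+ 2).
    by rewrite mulr_ge0// ?addr_ge0 ?mulr_ge0 ?sqr_ge0// ltW.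
  have h3 : 0 <= expR s * (l ^+ 2) by rewrite mulr_ge0 ?sqr_ge0// ltW.
  have h4 : 0 <= `|q s| * (l ^+ 2) by rewrite mulr_ge0 ?sqr_ge0.
  rewrite -subr_ge0 (_ : _ - _ = expR s * (d - l) ^+ 2 + p s * (d * d + l ^+ 2) +
    4 * (expR s * (l ^+ 2)) + 4 * (`|q s| * (l ^+ 2))); last by ring.
  by rewrite !addr_ge0// mulr_ge0.
move=> H; rewrite -[_ - _]/(D t) -[th1 t0 - _]/(D t0).
have K0 : 0 <= K by lra.
rewrite -(@ler_pXn2r _ 2)// ?nnegrE ?mulr_ge0 ?addr_ge0//.
rewrite real_normK ?num_real//.
rewrite -!expr2 -(real_normK (num_real (D t0))) in H.
set d := `|D t0| in H *; set l := `|l1 - l2| in H *.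
have d0 : 0 <= d by exact: normr_ge0.
have l0 : 0 <= l by exact: normr_ge0.
apply: (@le_trans _ _ ((d ^+ 2 + l ^+ 2) * K)).
  by apply: le_trans H; rewrite lerDl sqr_ge0.
rewrite exprMn mulrC expr2 -mulrA ler_wpM2l//.
apply: (@le_trans _ _ (1 * (d + l) ^+ 2)).
  by rewrite mul1r sqrrD -addrA lerD2l lerDr mulrn_wge0// mulr_ge0.
by rewrite ler_wpM2r// sqr_ge0.
Qed.

Lemma pruefer_variation s t : exists B, forall lambda theta, `|lambda| <= 1 ->
  pruefer_solution lambda theta -> `|theta t - theta s| <= B.
Proof.
have [Lam dLam] := antiderivative continuous_pruefer_rate.
exists `|Lam t - Lam s| => lambda theta l1 sol.
have H a b : a <= b -> `|theta b - theta a| <= `|Lam b - Lam a|.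
  move=> ab; apply: (le_trans _ (ler_norm _)).
  apply: (derive_norm_le_incr ab (fun z _ => sol z) (fun z _ => dLam z)) => z _.
  exact: pruefer_le_rate.
case: (leP s t) => [/H//|/ltW /H].
by rewrite distrC [leRHS]distrC.
Qed.

Lemma pruefer_compactness (la l1 t0 M : R) (l : nat -> R)
    (th : nat -> R -> R) :
  (forall n, la <= l n <= l1) -> (forall n, pruefer_solution (l n) (th n)) ->
  (forall n, `|th n t0| <= M) ->
  exists lambda theta, [/\ la <= lambda <= l1, pruefer_solution lambda theta &
    forall t x x' N, (forall n, (N <= n)%N -> x <= th n t <= x') ->
      x <= theta t <= x'].
Proof.
move=> lP sol thM.
have cK : compact (`[la, l1] `*` `[- M, M] : set (R * R)).
  by apply: compact_setX; exact: segment_compact.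
have [|[lambda phi] [[/= lam _] cl]] := cK ((fun n => (l n, th n t0)) @ \oo).
  by exists 0%N => // n _; split => /=; rewrite in_itv/= ?lP// -ler_norml.
have [theta [th0 s]] := pruefer_solution_exists lambda t0 phi.
exists lambda, theta; split => //.
have close t e N : 0 < e -> exists2 n, (N <= n)%N & `|th n t - theta t| < e.
  move=> e0; have [K K0 HK] := pruefer_dependence t0 t.
  pose d := e / (2 * (K + 1)).
  have d0 : 0 < d by rewrite divr_gt0// mulr_gt0// ltr_wpDl.
  have A1 : ((fun n => (l n, th n t0)) @ \oo)
      [set x | exists2 n, (N <= n)%N & x = (l n, th n t0)].
    by exists N => // n /= Nn; exists n.
  have [x [[n Nn ->]]] := cl _ _ A1 (nbhsx_ballx (lambda, phi) d d0).
  case=> /= B1 B2; exists n => //; move: B1 B2; rewrite /ball/= => B1 B2.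
  apply: le_lt_trans (HK _ _ _ _ (sol n) s) _; rewrite th0 distrC [X in _ + X]distrC.
  apply: (@le_lt_trans _ _ (K * (2 * d))); first by rewrite ler_wpM2l//; lra.
  rewrite /d (_ : K * _ = e * (K / (K + 1))).
    by rewrite gtr_pMr// ltr_pdivrMr ?ltr_wpDl// mul1r ltrDl.
  by field; lra.
move=> t x x' N H; apply/andP; split; apply/ler_addgt0Pr => e e0;
  have [n Nn C] := close t e N e0; have /andP[] := H n Nn;
  by move: C; rewrite ltr_distl; lra.
Qed.

End PrueferEquation.

(** * Shooting *)

Section Shooting.
Variable R : realType.
Variables p q : R -> R.
Hypotheses (cp : continuous p) (cq : continuous q) (p_gt0 : forall t, 0 < p t).
Variables sg T0 : R.
Hypothesis sgE : sg = 1 \/ sg = -1.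
Hypothesis q_dominates : forall t, t <= T0 -> p t + 2 * expR t <= sg * q t.
Hypothesis p_small : forall e, 0 < e ->
  exists T, forall t, T <= t -> p t <= e * expR t.
Hypothesis p_dominates : exists c T, 0 < c /\ forall t, T <= t ->
  [/\ c <= p t, c <= expR t & 2 * q t ^+ 2 <= p t * expR t].
Implicit Types (lambda t x d c : R) (m : nat).

Local Notation pruefer := (pruefer p q).
Local Notation sol := (pruefer_solution p q).

Lemma cos_sin_double_shift m x :
  cos (2 * (m%:R * pi + x)) = cos (2 * x) /\
  sin (2 * (m%:R * pi + x)) = sin (2 * x) :> R.
Proof.
have -> : 2 * (m%:R * pi + x) = 2 * x + (pi *+ 2) *+ m.
  by rewrite -[(pi *+ 2) *+ m]mulr_natl -[pi *+ 2]mulr_natl; ring.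
by split; [apply: (periodicn (@cosD2pi R)) | apply: (periodicn (@sinD2pi R))].
Qed.

Definition start_angle : R := if sg == 1 then 0 else pi / 2.

Lemma cos_sin_double_start x :
  cos (2 * (start_angle + x)) = sg * cos (2 * x) /\
  sin (2 * (start_angle + x)) = sg * sin (2 * x) :> R.
Proof.
rewrite /start_angle; case: sgE => ->; first by rewrite eqxx add0r !mul1r.
have -> : (-1 == 1 :> R) = false by apply/eqP; lra.
have -> : 2 * (pi / 2 + x) = 2 * x + pi by field.
by rewrite cosDpi sinDpi !mulN1r.
Qed.

Lemma sg_sqr : sg * sg = 1.
Proof. by case: sgE => ->; rewrite ?mulrNN mulr1. Qed.

Lemma start_angle_bound : `|start_angle| <= pi / 2.
Proof.
have pi0 := pi_gt0 R; rewrite /start_angle; case: ifP => _.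
  by rewrite normr0 divr_ge0 ?ltW.
by rewrite ger0_norm// divr_ge0// ltW.
Qed.

Lemma two_pi4 : 2 * (pi / 4) = pi / 2 :> R. Proof. by field. Qed.

Local Notation start_zone x := (start_angle - pi / 4 <= x <= start_angle + pi / 4).
Local Notation end_zone m x := (m%:R * pi - pi / 2 <= x <= m%:R * pi).

Lemma start_zone_invariant lambda theta a t : 0 <= lambda <= 1 -> sol lambda theta ->
  a <= t <= T0 -> start_zone (theta a) -> start_zone (theta t).
Proof.
move=> /andP[l0 l1] s /andP[aT tT] /andP[th1 th2].
have cF := continuous_pruefer cp cq (lambda := lambda) (pruefer_solution_continuous s).
have lr z : 0 <= lambda * expR z <= expR z.
  by rewrite mulr_ge0 ?expR_ge0//= ler_piMl// expR_ge0.
apply/andP; split.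
  apply: (barrier_below aT s cF _ th1) => z /andP[_ zt] ->.
  rewrite /pruefer; have [-> ->] := cos_sin_double_start (- (pi / 4)).
  rewrite mulrN two_pi4 cosN sinN cos_pihalf sin_pihalf.
  have := q_dominates (le_trans zt tT); have := p_gt0 z; have := lr z.
  have := expR_gt0 z; lra.
apply: (barrier_above aT s cF _ th2) => z /andP[_ zt] ->.
rewrite /pruefer; have [-> ->] := cos_sin_double_start (pi / 4).
rewrite two_pi4 cos_pihalf sin_pihalf.
have := q_dominates (le_trans zt tT); have := p_gt0 z; have := lr z.
have := expR_gt0 z; lra.
Qed.

Lemma end_zone_upper lambda theta m s t : 0 <= lambda -> sol lambda theta ->
  s <= t -> m%:R * pi <= theta s -> m%:R * pi <= theta t.
Proof.
move=> l0 so st; apply: (barrier_below st so) => [|z _ ->].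
  exact: (continuous_pruefer cp cq (lambda := lambda) (pruefer_solution_continuous so)).
rewrite /pruefer -[m%:R * pi]addr0; have [-> ->] := cos_sin_double_shift m 0.
rewrite mulr0 cos0 sin0; have := p_gt0 z; have := expR_gt0 z.
have : 0 <= lambda * expR z by rewrite mulr_ge0 ?expR_ge0.
lra.
Qed.

Lemma end_zone_lower lambda theta m s t : sol lambda theta -> s <= t ->
  (forall z, s <= z -> p z < (1 - lambda) * expR z) ->
  theta s <= m%:R * pi - pi / 2 -> theta t <= m%:R * pi - pi / 2.
Proof.
move=> so st small; apply: (barrier_above st so) => [|z /andP[sz _] ->].
  exact: (continuous_pruefer cp cq (lambda := lambda) (pruefer_solution_continuous so)).
rewrite /pruefer; have [-> ->] := cos_sin_double_shift m (- (pi / 2)).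
rewrite mulrN (_ : 2 * (pi / 2) = pi); last by field.
rewrite cosN sinN cospi sinpi; have := small z sz; lra.
Qed.

Lemma rotation_rate c d t x : c <= p t -> c <= expR t ->
  2 * q t ^+ 2 <= p t * expR t -> c / 2 - d * expR t <= pruefer (1 - d) t x.
Proof.
move=> cpt cr qpr; rewrite /pruefer.
have -> : 2 * x = x *+ 2 by rewrite mulr_natl.
rewrite cos_mulr2n sin_mulr2n; have := cos2Dsin2 x; have := p_gt0 t.
have := expR_gt0 t; move: (cos x) (sin x) (expR t) cr qpr => C S r cr qpr r0 p0 E.
have H : 2 * (q t * (S * C)) <= r * C ^+ 2 + p t / 2 * S ^+ 2.
  rewrite -(ler_pM2l r0).
  have h1 : 0 <= (r * C - q t * S) ^+ 2 by exact: sqr_ge0.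
  have h2 : 2 * q t ^+ 2 * S ^+ 2 <= p t * r * S ^+ 2.
    by rewrite ler_wpM2r ?sqr_ge0.
  rewrite (_ : r * (2 * _) = 2 * (r * C) * (q t * S)); last by ring.
  rewrite (_ : r * (_ + _) = (r * C) ^+ 2 + (p t * r * S ^+ 2) / 2); last by field.
  move: h1 h2; rewrite sqrrB !exprMn; lra.
have h3 : c / 2 * C ^+ 2 <= (r + p t) * C ^+ 2.
  by rewrite ler_wpM2r ?sqr_ge0//; lra.
have h4 : c / 2 * S ^+ 2 <= p t / 2 * S ^+ 2.
  by rewrite ler_wpM2r ?sqr_ge0//; lra.
rewrite !mulr2n; set C2 := C ^+ 2 in E H h3 h4 *; set S2 := S ^+ 2 in E H h3 h4.
have e1 : p t = p t * C2 + p t * S2 by rewrite -mulrDr E mulr1.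
have e2 : c / 2 = c / 2 * C2 + c / 2 * S2 by rewrite -mulrDr E mulr1.
rewrite [X in X - _]e2 {1}e1.
lra.
Qed.

Lemma boundary_value_problem la l1 m a b : a <= b -> la <= l1 ->
  (forall theta, sol la theta -> theta a = start_angle ->
     theta b <= m%:R * pi - pi / 4) ->
  (forall theta, sol l1 theta -> theta a = start_angle ->
     m%:R * pi - pi / 4 <= theta b) ->
  exists2 lambda, la <= lambda <= l1 &
    exists theta, [/\ sol lambda theta, theta a = start_angle &
      theta b = m%:R * pi - pi / 4].
Proof.
move=> ab lal1 Ha Hb.
have /choice[S SP] : forall lambda, exists theta,
    theta a = start_angle /\ sol lambda theta.
  by move=> lambda; exact: pruefer_solution_exists.
pose h lambda := S lambda b.
have [K K0 HK] := pruefer_dependence cp cq p_gt0 a b.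
have ch : continuous h.
  apply: (@continuous_of_dominated _ h (fun x => K * x)).
    by move=> x; apply: continuous_scalef.
  move=> x y; rewrite -mulrBr normrM (ger0_norm K0).
  have := HK _ _ _ _ (SP x).2 (SP y).2.
  by rewrite !(SP _).1 subrr normr0 add0r.
have [||l ll hl] := @IVT R h la l1 (m%:R * pi - pi / 4) lal1.
- exact: continuous_subspaceT.
- have [[a0 s0] [a1 s1]] := (SP la, SP l1).
  by rewrite ge_min le_max (Ha _ s0 a0) (Hb _ s1 a1) orbT.
exists l; first by move: ll; rewrite in_itv.
by exists (S l); split => //; [exact: (SP _).2 | exact: (SP _).1].
Qed.

Section TwoParameters.
Variables (la l1 T1 : R) (m : nat).
Hypotheses (la_ge0 : 0 <= la) (la_le_l1 : la <= l1) (l1_lt1 : l1 < 1).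
Hypothesis T0_le_T1 : T0 <= T1.
Hypothesis p_lt : forall t, T1 <= t -> p t < (1 - l1) * expR t.
Hypothesis la_below : forall theta, sol la theta -> start_zone (theta T0) ->
  theta T1 <= m%:R * pi - pi / 2.
Hypothesis l1_above : forall theta, sol l1 theta -> start_zone (theta T0) ->
  m%:R * pi <= theta T1.

Lemma connection_on_segment a b : a <= T0 -> T1 <= b ->
  exists lambda theta, [/\ la <= lambda <= l1, sol lambda theta,
    forall t, a <= t <= T0 -> start_zone (theta t) &
    forall t, T1 <= t <= b -> end_zone m (theta t)].
Proof.
move=> aT Tb; have pi0 := pi_gt0 R.
have ab : a <= b by apply: (le_trans aT); apply: le_trans Tb.
have aTT : a <= T0 <= T0 by rewrite aT lexx.
have start theta : theta a = start_angle -> start_zone (theta a).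
  by move=> ->; apply/andP; split; lra.
have la01 : 0 <= la <= 1 by rewrite la_ge0 (le_trans la_le_l1 (ltW l1_lt1)).
have l101 : 0 <= l1 <= 1 by rewrite (le_trans la_ge0 la_le_l1) ltW.
have small lambda t : lambda <= l1 -> T1 <= t -> p t < (1 - lambda) * expR t.
  move=> ll /p_lt pt; apply: (lt_le_trans pt).
  by rewrite ler_wpM2r ?expR_ge0//; lra.
have below theta : sol la theta -> theta a = start_angle ->
    theta b <= m%:R * pi - pi / 4.
  move=> so /start/(start_zone_invariant la01 so aTT)/(la_below so).
  by move=> /(end_zone_lower so Tb (small la ^~ la_le_l1)); lra.
have above theta : sol l1 theta -> theta a = start_angle ->
    m%:R * pi - pi / 4 <= theta b.
  move=> so /start/(start_zone_invariant l101 so aTT)/(l1_above so).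
  by move=> /(end_zone_upper (andP l101).1 so Tb); lra.
have [l /andP[ll1 ll2] [theta [so tha thb]]] :=
  boundary_value_problem ab la_le_l1 below above.
have l01 : 0 <= l <= 1 by apply/andP; split; lra.
exists l, theta; split => //; first by rewrite ll1.
  by move=> t tP; exact: (start_zone_invariant l01 so tP (start _ tha)).
move=> t /andP[t1 t2]; apply/andP; split; rewrite leNgt; apply/negP => H.
  suff : theta b <= m%:R * pi - pi / 2 by rewrite thb; lra.
  apply: (end_zone_lower so t2) (ltW H) => z tz.
  by apply: small => //; exact: le_trans tz.
by have := end_zone_upper (andP l01).1 so t2 (ltW H); rewrite thb; lra.
Qed.

Lemma connection_on_line : exists lambda theta, [/\ la <= lambda <= l1,
  sol lambda theta, forall t, t <= T0 -> start_zone (theta t) &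
  forall t, T1 <= t -> end_zone m (theta t)].
Proof.
have bvp n : exists lambda theta, [/\ la <= lambda <= l1, sol lambda theta,
    forall t, T0 - n%:R <= t <= T0 -> start_zone (theta t) &
    forall t, T1 <= t <= T1 + n%:R -> end_zone m (theta t)].
  by apply: connection_on_segment; rewrite ?gerBl ?lerDl.
have [ln /choice[thn P]] := choice bvp.
have [||| l [theta [lP so Hcl]]] := @pruefer_compactness
  _ p q cp cq p_gt0 la l1 T0 (`|start_angle| + pi / 4) ln thn.
- by move=> n; have [] := P n.
- by move=> n; have [] := P n.
- move=> n; have [_ _ /(_ T0) Z _] := P n.
  have /Z /andP[z1 z2] : T0 - n%:R <= T0 <= T0 by rewrite lexx gerBl ler0n.
  rewrite ler_norml; have := ler_norm start_angle.
  by have := lerNnormlW (lexx `|start_angle|); move=> *; apply/andP; split; lra.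
have arch x : exists N : nat, forall n, (N <= n)%N -> x <= n%:R.
  exists (Num.bound `|x|) => n; rewrite -(ler_nat R); apply: le_trans.
  by apply: (le_trans (ler_norm x)); rewrite ltW ?archi_boundP.
exists l, theta; split => // t tT.
  have [N HN] := arch (T0 - t); apply: (Hcl t _ _ N) => n /HN Nn.
  by have [_ _ Z _] := P n; apply: Z; rewrite tT andbT lerBlDr -lerBlDl.
have [N HN] := arch (t - T1); apply: (Hcl t _ _ N) => n /HN Nn.
by have [_ _ _ Z] := P n; apply: Z; rewrite tT/= -lerBlDl.
Qed.

End TwoParameters.

Lemma slow_start e : 0 < e < 1 -> exists m Ta, forall theta t, Ta <= t ->
  sol (1 - e) theta -> start_zone (theta T0) -> theta t <= m%:R * pi - pi / 2.
Proof.
move=> /andP[e0 e1]; have pi0 := pi_gt0 R; have pi2 := pi_ge2 R.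
have e20 : 0 < e / 2 by rewrite divr_gt0.
have [Ta HTa] := p_small e20.
have [B HB] := pruefer_variation cp cq p_gt0 T0 Ta.
exists (Num.bound `|B|).+2, Ta => theta t Tat so /andP[_ z0].
have mB : B + 5 / 4 * pi <= (Num.bound `|B|).+2%:R * pi.
  have := archi_boundP (normr_ge0 B); have := ler_norm B.
  rewrite -addn2 natrD; set k := _%:R => Bk kB.
  have : 0 <= k * (pi - 1) by rewrite mulr_ge0 ?ler0n//; lra.
  lra.
have : theta Ta <= (Num.bound `|B|).+2%:R * pi - pi / 2.
  have := HB (1 - e) theta; rewrite ger0_norm; last by lra.
  have e1' : 1 - e <= 1 by lra.
  move=> /(_ e1' so) /ler_normlW.
  by have := start_angle_bound => /ler_normlW; lra.
apply: (end_zone_lower so Tat) => z /HTa pz; apply: (le_lt_trans pz).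
by rewrite subKr ltr_pM2r ?expR_gt0//; lra.
Qed.

Lemma fast_rotation m e : 0 < e < 1 -> exists d tb, 0 < d <= e /\
  forall theta t, tb <= t -> sol (1 - d) theta -> start_zone (theta T0) ->
  m%:R * pi <= theta t.
Proof.
move=> /andP[e0 e1]; have pi0 := pi_gt0 R.
have [c [T [c0 HT]]] := p_dominates.
have [B HB] := pruefer_variation cp cq p_gt0 T0 T.
pose X := m%:R * pi + 3 / 4 * pi + `|B|.
have X0 : 0 <= X.
  by rewrite !addr_ge0 ?mulr_ge0 ?ler0n ?invr_ge0 ?(ltW pi0).
pose tb := T + 4 / c * X.
have Ttb : T <= tb by rewrite lerDl !mulr_ge0// ?invr_ge0 ltW.
pose d := Num.min e (c / 4 / expR tb).
have d0 : 0 < d by rewrite lt_min e0 !divr_gt0 ?expR_gt0.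
have de : d <= e by rewrite ge_min lexx.
have dr t : t <= tb -> d * expR t <= c / 4.
  move=> ttb; apply: (@le_trans _ _ (d * expR tb)).
    by rewrite ler_wpM2l ?(ltW d0)// ler_expR.
  by rewrite -ler_pdivlMr ?expR_gt0// ge_min lexx orbT.
clearbody d; have l0 : 0 <= 1 - d by lra.
exists d, tb; split; first by rewrite d0.
move=> theta t tbt so /andP[z0 _]; apply: (end_zone_upper l0 so tbt).
have th_T : - (3 / 4 * pi) - `|B| <= theta T.
  have := HB (1 - d) theta; rewrite ger0_norm//.
  have l1 : 1 - d <= 1 by lra.
  move=> /(_ l1 so) /lerNnormlW; have := ler_norm B.
  by have := start_angle_bound => /lerNnormlW; lra.
have lin (z : R) : is_derive z 1 (fun z => c / 4 * z) (c / 4 * 1).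
  exact: (is_derive_scalef _ (is_derive_idf z)).
have H : c / 4 * tb - c / 4 * T <= theta tb - theta T.
  apply: (derive_le_incr Ttb (fun z _ => lin z) (fun z _ => so z)).
  move=> z /andP[Tz ztb]; have [h1 h2 h3] := HT z Tz.
  by have := rotation_rate d (theta z) h1 h2 h3; have := dr z ztb; lra.
have E : c / 4 * tb - c / 4 * T = X by rewrite /tb; field; lra.
by move: H; rewrite E /X; lra.
Qed.

Theorem connecting_angle e : 0 < e < 1 ->
  exists lambda theta m, [/\ 1 - e <= lambda < 1, sol lambda theta,
    forall t, t <= T0 -> start_zone (theta t) &
    exists T1, forall t, T1 <= t ->
      end_zone m (theta t) /\ p t <= (1 - lambda) / 2 * expR t].
Proof.
move=> e01; have /andP[e0 e1] := e01.
have [m [Ta below]] := slow_start e01.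
have [d [tb [/andP[d0 de] above]]] := fast_rotation m e01.
have d20 : 0 < d / 2 by rewrite divr_gt0.
have [T' small] := p_small d20.
pose T1 := Num.max (Num.max Ta tb) (Num.max T0 T').
have [Ta1 tb1 T01 T'1] : [/\ Ta <= T1, tb <= T1, T0 <= T1 & T' <= T1].
  by split; rewrite !le_max lexx ?orbT.
have [||||t /(le_trans T'1)/small pt| || l [theta [/andP[l1 l2] so zone0 zone1]]] :=
  @connection_on_line (1 - e) (1 - d) T1 m; rewrite ?subr_ge0 ?ltrBlDr ?ltrDl ?lerB//.
- exact: ltW.
- by apply: (le_lt_trans pt); rewrite subKr ltr_pM2r ?expR_gt0//; lra.
- by move=> theta; exact: below.
- by move=> theta; exact: above.
exists l, theta, m; split => //; first by rewrite l1/=; lra.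
exists T1 => t tT; split; first exact: zone1.
apply: (le_trans (small t (le_trans T'1 tT))); rewrite ler_wpM2r ?expR_ge0//; lra.
Qed.

End Shooting.

(** * Square integrability *)

Section SquareIntegrability.
Variable R : realType.
Implicit Types (f g G : R -> R) (x a b C : R).
Local Notation mu := (@lebesgue_measure R).

Lemma itv0y_bigcup :
  `]0, +oo[%classic = \bigcup_n `[(n.+1%:R)^-1, n.+1%:R]%classic :> set R.
Proof.
apply/seteqP; split => [x|x [n _]] /=; rewrite !in_itv/= andbT; last first.
  by move=> /andP[nx _]; apply: lt_le_trans nx; rewrite invr_gt0 ltr0n.
move=> x0; exists (maxn (Num.truncn x) (Num.truncn x^-1)) => //=.
have h (y : R) k : (Num.truncn y <= k)%N -> y <= k.+1%:R.
  by move=> yk; apply: (le_trans (ltW (truncnS_gt y))); rewrite ler_nat ltnS.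
rewrite in_itv/=; apply/andP; split; last by apply: h; exact: leq_maxl.
by rewrite -(invrK x) lef_pV2 ?posrE ?invr_gt0// invrK; apply: h; exact: leq_maxr.
Qed.

Lemma integral_itv0y_le g G C :
  (forall x, 0 < x -> @continuous_at R R x g) -> (forall x, 0 < x -> 0 <= g x) ->
  (forall x, 0 < x -> is_derive x 1 G (g x)) ->
  (forall a b, 0 < a -> a <= b -> G b - G a <= C) ->
  (\int[mu]_(x in `]0%R, +oo[) (g x)%:E <= C%:E)%E.
Proof.
move=> cg g0 dG GC.
have sub n : (`[(n.+1%:R)^-1, n.+1%:R] : set R) `<=` `]0, +oo[.
  move=> x /=; rewrite !in_itv/= andbT => /andP[+ _].
  by apply: lt_le_trans; rewrite invr_gt0 ltr0n.
have mg : measurable_fun (`]0, +oo[ : set R) g.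
  apply: open_continuous_measurable_fun; first exact: interval_open.
  by move=> x; rewrite inE/= in_itv/= andbT => /cg.
have mgE : measurable_fun (`]0, +oo[ : set R) (EFin \o g) by exact/measurable_EFinP.
rewrite itv0y_bigcup.
have nd : nondecreasing_seq (fun n => `[(n.+1%:R)^-1, n.+1%:R]%classic : set R).
  move=> m n mn; rewrite subsetEset; apply: subset_itv; rewrite bnd_simp.
    by rewrite lef_pV2 ?posrE ?ltr0n// ler_nat ltnS.
  by rewrite ler_nat ltnS.
have gE0 n x : `[(n.+1%:R)^-1, n.+1%:R]%classic x -> (0 <= (g x)%:E)%E.
  by move=> /sub; rewrite /= in_itv/= andbT lee_fin => /g0.
have lim := ge0_nondecreasing_set_cvg_integral (mu := mu) nd
  (fun=> measurable_itv _)
  (fun n => measurable_funS (measurable_itv _) (sub n) mgE) gE0.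
apply: (cvge_le _ lim).
apply: nearW => -[|n].
  by rewrite invr1 set_itv1 integral_set1 lee_fin -(subrr (G 1)) GC.
have n1 : 1 < n.+2%:R :> R by rewrite ltr1n.
have nn : (n.+2%:R)^-1 < n.+2%:R :> R by apply: lt_trans (n1); rewrite invf_lt1 ?ltr0n.
have n0 : 0 < (n.+2%:R)^-1 :> R by rewrite invr_gt0 ltr0n.
have cc x : (n.+2%:R)^-1 <= x -> 0 < x by exact: lt_le_trans.
rewrite (continuous_FTC2 nn (F := G)).
- by rewrite -EFinB lee_fin GC// ltW.
- apply: continuous_in_subspaceT => x; rewrite inE/= in_itv/= => /andP[/cc x0 _].
  exact: cg.
- split.
  + by move=> x; rewrite in_itv/= => /andP[/ltW/cc/dG[]].
  + by apply: cvg_at_right_filter; exact: (is_derive_continuous (dG _ _)).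
  + apply: cvg_at_left_filter; apply: (is_derive_continuous (dG _ _)).
    exact: cc (ltW nn).
- move=> x; rewrite in_itv/= => /andP[/ltW/cc/dG dGx _].
  by rewrite derive1E derive_val.
Qed.

Lemma Lfun2_itv0y f g G C :
  (forall x, 0 < x -> @continuous_at R R x f) ->
  (forall x, 0 < x -> @continuous_at R R x g) ->
  (forall x, 0 < x -> f x ^+ 2 <= g x) ->
  (forall x, 0 < x -> is_derive x 1 G (g x)) ->
  (forall a b, 0 < a -> a <= b -> G b - G a <= C) ->
  f \_ `]0, +oo[ \in Lfun mu 2%:E.
Proof.
move=> cf cg fg dG GC.
have mf : measurable_fun (`]0, +oo[ : set R) f.
  apply: open_continuous_measurable_fun; first exact: interval_open.
  by move=> x; rewrite inE/= in_itv/= andbT => /cf.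
have mg : measurable_fun (`]0, +oo[ : set R) g.
  apply: open_continuous_measurable_fun; first exact: interval_open.
  by move=> x; rewrite inE/= in_itv/= andbT => /cg.
have mfr : measurable_fun setT (f \_ `]0, +oo[).
  by apply: (iffLR (measurable_restrictT _ _) mf); exact: measurable_itv.
apply/andP; split; first by rewrite inE/=.
rewrite inE /= /finite_norm unlock /Lnorm; apply: poweR_lty.
have -> : (\int[mu]_x (`|(EFin \o (f \_ `]0, +oo[)%R) x| `^ 2) =
    \int[mu]_(x in `]0%R, +oo[) (f x ^+ 2)%:E)%E.
  rewrite [RHS]integral_mkcond; apply: eq_integral => x _.
  rewrite /= !patchE; case: ifP => _.
    by rewrite powR_mulrn// real_normK ?num_real.
  by rewrite normr0 powR0.
have g0 x : 0 < x -> 0 <= g x.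
  by move=> x0; apply: (le_trans (sqr_ge0 (f x))); exact: fg.
apply: (le_lt_trans _ (ltry C)).
apply: (le_trans _ (integral_itv0y_le cg g0 dG GC)).
apply: ge0_le_integral => //.
- by move=> x _; rewrite lee_fin sqr_ge0.
- by apply/measurable_EFinP; exact: measurable_funX.
- exact/measurable_EFinP.
- by move=> x; rewrite /= in_itv/= andbT => /fg; rewrite lee_fin.
Qed.

End SquareIntegrability.

Section Amplitude.
Variable R : realType.
Variables p q : R -> R.
Hypothesis cq : continuous q.
Variables (lambda : R) (theta : R -> R).
Hypothesis sol : pruefer_solution p q lambda theta.
Implicit Types (A : R -> R) (s t x : R).

Lemma double_cos x : cos (2 * x) = 2 * cos x ^+ 2 - 1.
Proof. by rewrite mulr_natl cos_mulr2n -mulr_natl. Qed.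

Lemma double_sin x : sin (2 * x) = 2 * (cos x * sin x).
Proof. by rewrite mulr_natl sin_mulr2n -mulr_natl. Qed.

Lemma amplitude_exists : exists A,
  [/\ forall t, 0 < A t, continuous A,
    forall t, is_derive t 1 (fun s => A s * cos (theta s))
      (q t * (A t * cos (theta t)) +
       (expR t - lambda * expR t - p t) * (A t * sin (theta t))) &
    forall t, is_derive t 1 (fun s => A s * sin (theta s))
      ((lambda * expR t + expR t + p t) * (A t * cos (theta t)) -
       q t * (A t * sin (theta t)))].
Proof.
have cth := pruefer_solution_continuous sol.
have [|eta deta] := @antiderivative R
  (fun t => q t * cos (2 * theta t) + expR t * sin (2 * theta t)).
  move=> t; have c2 := continuous_scalef (c := 2) (cth t).
  apply: continuous_addf; apply: continuous_mulf.
  - exact: cq.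
  - exact: (continuous_compf (@continuous_cos _ _) c2).
  - exact: continuous_expR.
  - exact: (continuous_compf (@continuous_sin _ _) c2).
have dA t := is_derive_expRf (deta t).
exists (fun t => expR (eta t)); split => [t|t|t|t]; first exact: expR_gt0.
- exact: (is_derive_continuous (dA t)).
- apply: (is_derive_eq (is_derive_mulf (dA t) (is_derive_cosf (sol t)))).
  apply/eqP; rewrite -subr_eq0 /pruefer double_cos double_sin.
  set C := cos _; set S := sin _; set E := expR (eta t); set r := expR t.
  rewrite (_ : _ - _ = 2 * E * q t * C * (C ^+ 2 + S ^+ 2 - 1)); last by ring.
  by rewrite cos2Dsin2 subrr mulr0.
- apply: (is_derive_eq (is_derive_mulf (dA t) (is_derive_sinf (sol t)))).
  apply/eqP; rewrite -subr_eq0 /pruefer double_cos double_sin.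
  set C := cos _; set S := sin _; set E := expR (eta t); set r := expR t.
  rewrite (_ : _ - _ = 2 * E * r * C * (C ^+ 2 + S ^+ 2 - 1)); last by ring.
  by rewrite cos2Dsin2 subrr mulr0.
Qed.

Section Energy.
Variables A G : R -> R.
Hypothesis dU : forall t, is_derive t 1 (fun s => A s * cos (theta s))
  (q t * (A t * cos (theta t)) +
   (expR t - lambda * expR t - p t) * (A t * sin (theta t))).
Hypothesis dW : forall t, is_derive t 1 (fun s => A s * sin (theta s))
  ((lambda * expR t + expR t + p t) * (A t * cos (theta t)) -
   q t * (A t * sin (theta t))).
Hypothesis dG : forall t, is_derive t 1 G (expR t * A t ^+ 2).

Lemma energy_bound_left sg T0 s : sg = 1 \/ sg = -1 -> 0 <= lambda <= 1 ->
  (forall t, 0 < p t) ->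
  (forall t, t <= T0 -> p t + 2 * expR t <= sg * q t) ->
  (forall t, t <= T0 -> 0 <= sg * cos (2 * theta t)) ->
  s <= T0 -> G T0 - G s <= A T0 ^+ 2.
Proof.
move=> sgE /andP[l0 l1] p_gt0 qdom zone sT.
pose U t := A t * cos (theta t); pose W t := A t * sin (theta t).
pose D t := sg * (U t * U t - W t * W t).
have sumE t : U t ^+ 2 + W t ^+ 2 = A t ^+ 2.
  by rewrite !exprMn -mulrDr cos2Dsin2 mulr1.
have DE t : D t = A t ^+ 2 * (sg * cos (2 * theta t)).
  rewrite double_cos.
  rewrite (_ : D t = sg * A t ^+ 2 * (cos (theta t) ^+ 2 - sin (theta t) ^+ 2)).
    by rewrite sin2cos2; ring.
  by rewrite /D /U /W; ring.
have dD t := is_derive_scalef sg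
  (is_derive_subf (is_derive_mulf (dU t) (dU t)) (is_derive_mulf (dW t) (dW t))).
have := derive_le_incr sT (fun t _ => dG t) (fun t _ => dD t).
move=> H; apply: (le_trans (H _)).
  move=> t /andP[_ tT]; rewrite -sumE -/(U t) -/(W t).
  have := qdom t tT; have := p_gt0 t; have := expR_gt0 t.
  move: (U t) (W t) (expR t) (p t) (q t) => u v r P Q r0 P0 h.
  have w0 : 0 <= u ^+ 2 + v ^+ 2 by rewrite addr_ge0 ?sqr_ge0.
  have h1 : 0 <= (sg * Q - P - 2 * r) * (u ^+ 2 + v ^+ 2).
    by apply: mulr_ge0 => //; lra.
  have h2 : 0 <= (lambda * r + P) * (u + sg * - v) ^+ 2.
    by rewrite mulr_ge0 ?sqr_ge0// addr_ge0 ?mulr_ge0// ltW.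
  have h4 : 0 <= r * (u ^+ 2 + v ^+ 2) by rewrite mulr_ge0// ltW.
  have h3 : 0 <= (1 - lambda) * (r * (u ^+ 2 + v ^+ 2)) by apply: mulr_ge0 => //; lra.
  move: h1 h2; case: sgE => ->; rewrite ?mulN1r ?mul1r ?opprK => h1 h2; nra.
rewrite -/(D T0) -/(D s) !DE; have := zone s sT.
have : sg * cos (2 * theta T0) <= 1.
  case: sgE => ->; have := cos_le1 (2 * theta T0); have := cos_geN1 (2 * theta T0); lra.
have := sqr_ge0 (A T0); have := sqr_ge0 (A s).
move: (A s ^+ 2) (A T0 ^+ 2) (sg * cos (2 * theta T0)) (sg * cos (2 * theta s)).
move=> a b c d a0 b0 c1 d0.
have : 0 <= a * d by rewrite mulr_ge0.
have : b * c <= b by rewrite ler_piMr.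
lra.
Qed.

Lemma energy_bound_right T1 s : lambda < 1 ->
  (forall t, T1 <= t ->
     sin (2 * theta t) <= 0 /\ p t <= (1 - lambda) / 2 * expR t) ->
  0 <= lambda -> (forall t, 0 < p t) ->
  T1 <= s -> G s - G T1 <= A T1 ^+ 2 / (1 - lambda).
Proof.
move=> l1 zone l0 p_gt0 Ts.
pose U t := A t * cos (theta t); pose W t := A t * sin (theta t).
have sumE t : U t ^+ 2 + W t ^+ 2 = A t ^+ 2.
  by rewrite !exprMn -mulrDr cos2Dsin2 mulr1.
have DE t : U t * W t = A t ^+ 2 * sin (2 * theta t) / 2.
  by rewrite double_sin /U /W; field.
have dD t := is_derive_scalef (2 / (1 - lambda)) (is_derive_mulf (dU t) (dW t)).
have := derive_le_incr Ts (fun t _ => dG t) (fun t _ => dD t).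
move=> H; apply: (le_trans (H _)).
  move=> t /andP[Tt _]; rewrite -sumE -/(U t) -/(W t).
  rewrite [leRHS]mulrAC ler_pdivlMr ?subr_gt0//.
  have [_] := zone t Tt; have := p_gt0 t; have := expR_gt0 t.
  move: (U t) (W t) (expR t) (p t) (q t) => u v r P Q r0 P0 h.
  have h1 : 0 <= ((1 - lambda) / 2 * r - P) * v ^+ 2.
    by rewrite mulr_ge0 ?sqr_ge0//; lra.
  have h2 : 0 <= (2 * lambda * r + P) * u ^+ 2.
    by rewrite mulr_ge0 ?sqr_ge0// addr_ge0 ?mulr_ge0 ?(ltW r0) ?(ltW P0).
  have h3 : 0 <= (1 - lambda) * r * u ^+ 2.
    by apply: mulr_ge0; rewrite ?sqr_ge0//; apply: mulr_ge0; [lra | exact: ltW].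
  nra.
have [s1 _] := zone s Ts; have sT := sin_geN1 (2 * theta T1).
rewrite -/(U s) -/(W s) -/(U T1) -/(W T1) !DE.
rewrite -mulrBr [leLHS]mulrAC ler_pM2r ?invr_gt0 ?subr_gt0//.
have : 0 <= A s ^+ 2 * - sin (2 * theta s) by rewrite mulr_ge0 ?sqr_ge0// oppr_ge0.
have : 0 <= A T1 ^+ 2 * (1 + sin (2 * theta T1)) by rewrite mulr_ge0 ?sqr_ge0//; lra.
lra.
Qed.

End Energy.

End Amplitude.

(** * Eigenfunctions *)

Section Eigenfunction.
Variable R : realType.
Implicit Types (f : R -> R) (x t : R).

Lemma loc_abs_continuous_C1 f f' :
  (forall x, 0 < x -> is_derive x 1 f (f' x)) ->
  (forall x, 0 < x -> @continuous_at R R x f') -> loc_abs_continuous f.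
Proof.
move=> df cf' a b a0 ab.
have pos x : a <= x -> 0 < x by exact: lt_le_trans.
have [|c _ cmax] := @EVT_max R (fun x => `|f' x|) a b (ltW ab).
  apply: continuous_in_subspaceT => x; rewrite inE/= in_itv/= => /andP[/pos x0 _].
  apply: (@continuous_compf _ (fun x => `|x|)); last exact: cf'.
  exact: norm_continuous.
set K := `|f' c|; have K0 : 0 <= K by exact: normr_ge0.
move=> e e0; exists (e / (K + 1)); first by rewrite divr_gt0// ltr_wpDl.
move=> n l r lr _ small.
apply: (@le_lt_trans _ _ ((K + 1) * \sum_(i < n) (r i - l i))); last first.
  by rewrite mulrC -ltr_pdivlMr// ltr_wpDl.
rewrite mulr_sumr; apply: ler_sum => i _; have [al lri rb] := lr i.
have lin (x : R) : is_derive x 1 (fun x => (K + 1) * x) ((K + 1) * 1).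
  exact: (is_derive_scalef _ (is_derive_idf x)).
rewrite mulrBr; apply: (derive_norm_le_incr lri (F' := f') _ (fun x _ => lin x)).
  by move=> x /andP[lx _]; apply/df/pos/(le_trans al).
move=> x /andP[lx xr]; rewrite mulr1 (le_trans (cmax x _)) ?lerDl//.
by rewrite in_itv/= (le_trans al lx) (le_trans xr rb).
Qed.

Lemma not_ae_eq_pos0 (z : R -> 'cV[R]_2) :
  (forall x, 0 < x -> z x <> 0) -> ~ ae_eq_pos z (fun=> 0).
Proof.
move=> z0 [N [mN N0 sub]].
have : (@lebesgue_measure R `]0%R, 1%R[ <= 0)%E.
  rewrite -N0; apply: le_measure; rewrite ?inE//.
  move=> x; rewrite /= in_itv/= => /andP[x0 _]; apply: sub => /= H.
  exact: (z0 x x0 (H x0)).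
by rewrite lebesgue_measure_itv/= lte_fin ltr01 -EFinB lee_fin subr0 ler10.
Qed.

Variables (mu_a : R) (k : int) (V : R -> R).
Hypothesis V_C1 : C1_pos V.

Definition offdiag x : R := - (k%:~R / x) - mu_a * derive1 V x.
(* Coefficients of the Pruefer equation in the variable t = ln x. *)
Definition log_p t : R := - (expR t * V (expR t)).
Definition log_q t : R := expR t * offdiag (expR t).

Lemma continuous_V x : 0 < x -> @continuous_at R R x V.
Proof.
by move=> /V_C1[dV _]; exact/differentiable_continuous/derivable1_diffP.
Qed.

Lemma continuous_offdiag x : 0 < x -> @continuous_at R R x offdiag.
Proof.
move=> x0; rewrite /offdiag; apply: continuous_subf.
  apply: continuous_oppf; apply: continuous_scalef.
  by apply: (@inv_continuous R); rewrite gt_eqF.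
by apply: continuous_scalef; exact: (V_C1 x0).2.
Qed.

Lemma continuous_log_p : continuous log_p.
Proof.
move=> t; apply: continuous_oppf; apply: continuous_mulf.
  exact: continuous_expR.
apply: (continuous_compf (continuous_V (expR_gt0 t))); exact: continuous_expR.
Qed.

Lemma continuous_log_q : continuous log_q.
Proof.
move=> t; apply: continuous_mulf; first exact: continuous_expR.
apply: (continuous_compf (continuous_offdiag (expR_gt0 t))); exact: continuous_expR.
Qed.

Lemma dirac_eigenvalue lambda theta sg T0 T1 :
  0 <= lambda < 1 -> pruefer_solution log_p log_q lambda theta ->
  (forall x, 0 < x -> V x < 0) -> sg = 1 \/ sg = -1 ->
  (forall t, t <= T0 -> log_p t + 2 * expR t <= sg * log_q t) ->
  (forall t, t <= T0 -> 0 <= sg * cos (2 * theta t)) ->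
  (forall t, T1 <= t -> sin (2 * theta t) <= 0 /\
     log_p t <= (1 - lambda) / 2 * expR t) ->
  A0_eigenvalue (dirac_P mu_a k V) lambda.
Proof.
move=> /andP[l0 l1] sol V_neg sgE qdom zone0 zone1.
have p_gt0 t : 0 < log_p t by rewrite oppr_gt0 nmulr_llt0 ?expR_gt0// V_neg ?expR_gt0.
have [A [A_gt0 cA dU dW]] := amplitude_exists continuous_log_q sol.
have [|G dG] := @antiderivative R (fun t => expR t * A t ^+ 2).
  move=> t; apply: continuous_mulf; first exact: continuous_expR.
  by apply: continuous_mulf; exact: cA.
have [C GC] : exists C, forall s t, s <= t -> G t - G s <= C.
  have left s := energy_bound_left dU dW dG sgE
    (_ : 0 <= lambda <= 1) p_gt0 qdom zone0 (s := s).
  have right s := energy_bound_right dU dW dG l1 zone1 l0 p_gt0 (s := s).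
  have Gmono s t : s <= t -> G s <= G t.
    move=> st; apply: (derive_ge0_le st (fun z _ => dG z)) => z _.
    by rewrite mulr_ge0 ?expR_ge0 ?sqr_ge0.
  exists (A T1 ^+ 2 / (1 - lambda) + (G (Num.max T0 T1) - G T0) + A T0 ^+ 2 +
          (G (Num.max T0 T1) - G T1)) => s t st.
  have h1 : G T0 - G (Num.min s T0) <= A T0 ^+ 2.
    by apply: left; rewrite ?l0 ?(ltW l1)// ge_min lexx orbT.
  have h2 : G (Num.max t T1) - G T1 <= A T1 ^+ 2 / (1 - lambda).
    by apply: right; rewrite le_max lexx orbT.
  have h3 : G (Num.min s T0) <= G s by apply: Gmono; rewrite ge_min lexx.
  have h4 : G t <= G (Num.max t T1) by apply: Gmono; rewrite le_max lexx.
  have h5 : G T0 <= G (Num.max T0 T1) by apply: Gmono; rewrite le_max lexx.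
  have h6 : G T1 <= G (Num.max T0 T1) by apply: Gmono; rewrite le_max lexx orbT.
  lra.
pose u x := A (ln x) * cos (theta (ln x)).
pose v x := A (ln x) * sin (theta (ln x)).
pose u' x := offdiag x * u x + (1 + V x - lambda) * v x.
pose v' x := (lambda + 1 - V x) * u x - offdiag x * v x.
have du x : 0 < x -> is_derive x 1 u (u' x).
  move=> x0; apply: (is_derive_eq (is_derive_compf (dU (ln x)) (is_derive1_ln x0))).
  rewrite /log_p /log_q lnK ?posrE// /u' /u /v; field; lra.
have dv x : 0 < x -> is_derive x 1 v (v' x).
  move=> x0; apply: (is_derive_eq (is_derive_compf (dW (ln x)) (is_derive1_ln x0))).
  rewrite /log_p /log_q lnK ?posrE// /v' /u /v; field; lra.
have cu x : 0 < x -> @continuous_at R R x u.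
  by move=> /du; exact: is_derive_continuous.
have cv x : 0 < x -> @continuous_at R R x v.
  by move=> /dv; exact: is_derive_continuous.
have cu' x : 0 < x -> @continuous_at R R x u'.
  move=> x0; apply: continuous_addf; apply: continuous_mulf.
  - exact: continuous_offdiag.
  - exact: cu.
  - apply: continuous_subf; last exact: cvg_cst.
    by apply: continuous_addf; [exact: cvg_cst | exact: continuous_V].
  - exact: cv.
have cv' x : 0 < x -> @continuous_at R R x v'.
  move=> x0; apply: continuous_subf; apply: continuous_mulf.
  - by apply: continuous_subf; [exact: cvg_cst | exact: continuous_V].
  - exact: cu.
  - exact: continuous_offdiag.
  - exact: cv.
pose g x := u x ^+ 2 + v x ^+ 2.
have cg x : 0 < x -> @continuous_at R R x g.
  move=> x0; apply: continuous_addf; apply: continuous_mulf;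
    by [exact: cu | exact: cv].
have gE x : g x = A (ln x) ^+ 2 by rewrite /g !exprMn -mulrDr cos2Dsin2 mulr1.
have dGx x : 0 < x -> is_derive x 1 (fun x => G (ln x)) (g x).
  move=> x0; apply: (is_derive_eq (is_derive_compf (dG (ln x)) (is_derive1_ln x0))).
  by rewrite gE lnK ?posrE//; field; lra.
have GCx a b : 0 < a -> a <= b -> G (ln b) - G (ln a) <= C.
  by move=> a0 ab; apply: GC; rewrite ler_ln// ?posrE// (lt_le_trans a0).
pose z x : 'cV[R]_2 := \col_(i < 2) if i == 0 then u x else v x.
have z0 : (fun x => z x 0 0) = u by apply/funext => x; rewrite mxE.
have z1 : (fun x => z x 1 0) = v by apply/funext => x; rewrite mxE.
have ord2 (P : 'I_2 -> Prop) : P 0 -> P 1 -> forall i, P i.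
  by move=> P0 P1 [[|[|//]] i2]; [have -> : Ordinal i2 = 0 by exact: val_inj
    | have -> : Ordinal i2 = 1 by exact: val_inj].
have tauz x : 0 < x -> tau (dirac_P mu_a k V) z x = lambda *: z x.
  move=> x0; have D0 : derive1 (fun t => z t 0 0) x = u' x.
    by have d := du x x0; rewrite z0 derive1E derive_val.
  have D1 : derive1 (fun t => z t 1 0) x = v' x.
    by have d := dv x x0; rewrite z1 derive1E derive_val.
  apply/matrixP => i j; rewrite (ord1 j) {j}; move: i; apply: ord2;
    rewrite !mxE !big_ord_recl !big_ord0 !mxE /=.
    rewrite (_ : lift ord0 ord0 = 1) ?D1; last exact: val_inj.
    by rewrite /v' /offdiag; ring.
  rewrite (_ : derive1 (fun t => z t ord0 0) x = u' x); last exact: D0.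
  by rewrite /u' /offdiag; ring.
exists z; split; last 1 first.
- by apply: aeW => x; exact: tauz.
- split.
  + apply: ord2; rewrite ?z0 ?z1; apply: (Lfun2_itv0y (g := g) _ cg _ dGx GCx) => //.
      by move=> x _; rewrite lerDl sqr_ge0.
    by move=> x _; rewrite lerDr sqr_ge0.
  + apply: ord2; rewrite ?z0 ?z1; first exact: loc_abs_continuous_C1 du cu'.
    exact: loc_abs_continuous_C1 dv cv'.
  + have tauE i : (fun x => tau (dirac_P mu_a k V) z x i 0) \_ `]0, +oo[ =
        (fun x => lambda * z x i 0) \_ `]0, +oo[.
      apply/funext => x; rewrite !patchE; case: ifPn => //.
      by rewrite inE/= in_itv/= andbT => /tauz ->; rewrite !mxE.
    have L2 f : (forall x, 0 < x -> @continuous_at R R x f) ->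
        (forall x, 0 < x -> f x ^+ 2 <= g x) ->
        (fun x => lambda * f x) \_ `]0, +oo[ \in Lfun (@lebesgue_measure R) 2%:E.
      move=> cf fg; apply: (@Lfun2_itv0y _ _ (fun x => lambda ^+ 2 * g x)
        (fun x => lambda ^+ 2 * G (ln x)) (lambda ^+ 2 * C)).
      - by move=> x /cf; exact: continuous_scalef.
      - by move=> x /cg; exact: continuous_scalef.
      - by move=> x /fg fgx; rewrite exprMn ler_wpM2l ?sqr_ge0.
      - by move=> x /dGx; exact: is_derive_scalef.
      - by move=> a b a0 ab; rewrite -mulrBr ler_wpM2l ?sqr_ge0// GCx.
    have fg0 x : u x ^+ 2 <= g x by rewrite lerDl sqr_ge0.
    have fg1 x : v x ^+ 2 <= g x by rewrite lerDr sqr_ge0.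
    apply: ord2; rewrite tauE.
      rewrite (_ : (fun x => _) = (fun x => lambda * u x)); first exact: L2.
      by apply/funext => x; rewrite mxE.
    rewrite (_ : (fun x => _) = (fun x => lambda * v x)); first exact: L2.
    by apply/funext => x; rewrite mxE.
- apply: not_ae_eq_pos0 => x x0 zx0.
  have : g x = 0.
    by rewrite /g -z0 -z1 zx0 !mxE expr0n addr0.
  by apply/eqP; rewrite gE sqrf_eq0 gt_eqF.
Qed.

End Eigenfunction.

(** * Asymptotics of the potential *)

Section LogarithmicScale.
Variable R : realType.
Implicit Types (h V rem : R -> R) (x t e gamma alpha a : R).

Lemma cvg0_log_pinfty h : h x @[x --> +oo] --> (0 : R) ->
  forall e, 0 < e -> exists T, forall t, T <= t -> `|h (expR t)| <= e.
Proof.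
move=> /cvgrPdist_le h0 e e0; have [M [_ HM]] := h0 e e0.
exists M => t Mt; rewrite -[h _]opprK normrN -sub0r; apply: HM.
by have := expR_ge1Dx t; lra.
Qed.

Lemma cvg0_log_right0 h : h x @[x --> 0^'+] --> (0 : R) ->
  forall e, 0 < e -> exists T, forall t, t <= T -> `|h (expR t)| <= e.
Proof.
move=> /cvgrPdist_le h0 e e0; have /nbhs_ballP[d /= d0 Hd] := h0 e e0.
exists (ln d - 1) => t tT; rewrite -[h _]opprK normrN -sub0r.
apply: Hd; last exact: expR_gt0.
rewrite /ball/= sub0r normrN gtr0_norm ?expR_gt0//.
by rewrite -(lnK (_ : d \in Num.pos)) ?posrE// ltr_expR; lra.
Qed.

Lemma expR_scale_small a e : 0 < a -> 0 < e ->
  exists T, forall t, t <= T -> expR (t * a) <= e.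
Proof.
move=> a0 e0; exists (ln e / a) => t tT.
by rewrite -(lnK (_ : e \in Num.pos)) ?posrE// ler_expR -ler_pdivlMr.
Qed.

Lemma expR_scale_large a e : 0 < a ->
  exists T, forall t, T <= t -> e <= expR (t * a).
Proof.
move=> a0; exists (e / a) => t tT; have := expR_ge1Dx (t * a).
by move: tT; rewrite ler_pdivrMr//; lra.
Qed.

Lemma V_expansion_log V gamma alpha rem t : V_expansion V gamma alpha rem ->
  expR (t * alpha) * V (expR t) = gamma + expR t `^ alpha * rem (expR t).
Proof.
move=> VE; rewrite (VE _ (expR_gt0 t)) expRM powRN mulrDr mulrCA divff ?mulr1//.
by rewrite -expRM expR_eq0.
Qed.

Lemma derive_V_expansion_log V gamma alpha rem t :
  C1_pos V -> V_expansion V gamma alpha rem ->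
  expR (t * alpha) * (expR t * derive1 V (expR t)) =
  - (gamma * alpha) + expR t `^ (alpha + 1) * derive1 rem (expR t).
Proof.
move=> V_C1 VE; set x := expR t; have x0 : 0 < x by exact: expR_gt0.
have dV : is_derive x 1 V (derive1 V x).
  by rewrite derive1E; apply: derivableP; exact: (V_C1 _ x0).1.
have dP := is_derive_scalef gamma (is_derive1_powR (- alpha) x0).
have dR : is_derive x 1 rem (derive1 V x - gamma * (- alpha * x `^ (- alpha - 1))).
  apply: (near_eq_is_derive _ (is_derive_subf dV dP)).
  near=> y; rewrite VE; last by near: y; exact: lt_nbhsr.
  by rewrite addrC addKr.
rewrite [derive1 rem x]derive1E (@derive_val _ _ _ _ _ _ _ dR).
have xa : x `^ (alpha + 1) = expR (t * alpha) * x.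
  rewrite powRD; last by rewrite (gt_eqF x0) implybT.
  by rewrite powRr1 ?(ltW x0)// expRM.
have xN : x `^ (- alpha - 1) = (x `^ (alpha + 1))^-1.
  by rewrite -powRN opprD.
rewrite xN xa; field.
by rewrite (gt_eqF x0) expR_eq0.
Unshelve. all: by end_near. Qed.

End LogarithmicScale.

Section Asymptotics.
Variable R : realType.
Variables (mu_a : R) (k : int) (V : R -> R).
Hypothesis V_C1 : C1_pos V.
Variables (gamma alpha : R) (rem : R -> R).
Implicit Types (t e : R).

Local Notation p := (log_p V).
Local Notation q := (log_q mu_a k V).

Lemma log_qE t : q t = - k%:~R - mu_a * (expR t * derive1 V (expR t)).
Proof. by rewrite /log_q /offdiag; field; rewrite expR_eq0. Qed.

Lemma log_p_small : cond_Vinfty V gamma alpha rem -> forall e, 0 < e ->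
  exists T, forall t, T <= t -> p t <= e * expR t.
Proof.
case=> VE g0 /andP[a0 a1] c1 _ e e0.
have [T1 H1] := cvg0_log_pinfty c1 ltr01.
have [T2 H2] := expR_scale_large ((1 - gamma) / e) a0.
exists (Num.max T1 T2) => t; rewrite ge_max => /andP[/H1 h1 /H2 h2].
have E := V_expansion_log t VE.
rewrite /log_p -mulrN mulrC ler_pM2r ?expR_gt0//.
rewrite -(ler_pM2l (expR_gt0 (t * alpha))) mulrN E.
move: h2; rewrite ler_pdivrMr// => h2; have := lerNnormlW h1; lra.
Qed.

Lemma log_p_dominates : cond_Vinfty V gamma alpha rem ->
  exists c T, 0 < c /\ forall t, T <= t ->
  [/\ c <= p t, c <= expR t & 2 * q t ^+ 2 <= p t * expR t].
Proof.
case=> VE g0 /andP[a0 a1] c1 c2.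
have g20 : 0 < - gamma / 2 by lra.
have [T1 H1] := cvg0_log_pinfty c1 g20.
have [T2 H2] := cvg0_log_pinfty c2 ltr01.
pose c := Num.min (- gamma / 2) 1.
have c0 : 0 < c by rewrite lt_min g20 ltr01.
pose B := `|k%:~R| + `|mu_a| * (`|gamma * alpha| + 1).
exists c, (Num.max (Num.max T1 T2) (Num.max 0 (2 * B ^+ 2 / c))); split => // t.
rewrite !ge_max => /andP[/andP[/H1 h1 /H2 h2] /andP[t0 tB]].
have r1 : 1 <= expR t by have := expR_ge1Dx t; lra.
have a_ge1 : 1 <= expR (t * alpha) by rewrite -expR0 ler_expR mulr_ge0// ltW.
have a_le : expR (t * alpha) <= expR t.
  by rewrite ler_expR ler_piMr.
have E := V_expansion_log t VE.
have cp : c <= p t.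
  apply: (@le_trans _ _ (- gamma / 2)); first by rewrite ge_min lexx.
  rewrite -(ler_pM2l (expR_gt0 (t * alpha))) /log_p.
  rewrite [leRHS](_ : _ = - (expR t * (expR (t * alpha) * V (expR t)))); last by ring.
  rewrite E -mulrN.
  apply: (@le_trans _ _ (expR t * (- gamma / 2))).
    by rewrite ler_pM2r.
  rewrite ler_pM2l ?expR_gt0//; have := ler_normlW h1; lra.
split => //; first by apply: le_trans r1; rewrite ge_min lexx orbT.
have qB : `|q t| <= B.
  rewrite log_qE; apply: (le_trans (ler_normB _ _)); rewrite normrN lerD2l.
  rewrite normrM ler_wpM2l//.
  have D := derive_V_expansion_log t V_C1 VE.
  apply: (@le_trans _ _ `|expR (t * alpha) * (expR t * derive1 V (expR t))|).
    by rewrite [leRHS]normrM (gtr0_norm (expR_gt0 _)) ler_peMl.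
  by rewrite D; apply: (le_trans (ler_normD _ _)); rewrite normrN lerD2l.
have qB2 : q t ^+ 2 <= B ^+ 2.
  by rewrite -[q t ^+ 2]real_normK ?num_real// lerXn2r ?nnegrE// (le_trans _ qB).
have h3 : 2 * B ^+ 2 <= c * expR t.
  move: tB; rewrite ler_pdivrMr// (mulrC t) => tB; apply: (le_trans tB).
  by rewrite ler_pM2l//; have := expR_ge1Dx t; lra.
have h4 : c * expR t <= p t * expR t by rewrite ler_pM2r ?expR_gt0.
lra.
Qed.

Lemma log_q_dominates : k != 0 -> cond_V0 mu_a k V gamma alpha rem ->
  exists sg T0 : R, (sg = 1 \/ sg = -1) /\
    forall t, t <= T0 -> p t + 2 * expR t <= sg * q t.
Proof.
move=> k0 [VE a0 mu0 muN0].
have sgN (y : R) : y != 0 -> exists sg : R, (sg = 1 \/ sg = -1) /\ sg * y = `|y|.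
  move=> y0; case: (ltP 0 y) => y1.
    by exists 1; split; [left | rewrite mul1r gtr0_norm].
  by exists (-1); split; [right | rewrite mulN1r ler0_norm].
have [mu_eq0|/eqP mu_neq0] := eqVneq mu_a 0.
  have [a1 c1 _ gk] := mu0 mu_eq0.
  have [|sg [sgE sgk]] := sgN (- k%:~R); first by rewrite oppr_eq0 intr_eq0.
  have gk' : `|gamma| < `|k%:~R : R|.
    rewrite -(@ltr_pXn2r _ 2)// ?nnegrE// !real_normK ?num_real//; lra.
  have d0 : 0 < (`|k%:~R| - `|gamma|) / 2 by lra.
  have [T1 H1] := cvg0_log_right0 c1 d0.
  have d40 : 0 < (`|k%:~R| - `|gamma|) / 4 by lra.
  have [T2 H2] := expR_scale_small ltr01 d40.
  exists sg, (Num.min T1 T2); split => // t; rewrite le_min => /andP[/H1 h1 /H2 h2].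
  rewrite log_qE mu_eq0 mul0r subr0 sgk normrN.
  have := V_expansion_log t VE; rewrite /log_p a1 mulr1 powRr1 ?expR_ge0// => ->.
  move: h2; rewrite mulr1; have := lerNnormlW h1; have := lerNnormlW (lexx `|gamma|).
  lra.
have [c1 c2 _ g0] := muN0 mu_neq0.
have y0 : mu_a * (gamma * alpha) != 0.
  by rewrite !mulf_neq0 ?(gt_eqF a0)//; apply/eqP.
have [sg [sgE sgy]] := sgN _ y0.
set D := `|mu_a * (gamma * alpha)| in sgy.
have D0 : 0 < D by rewrite normr_gt0.
have [T1 H1] := cvg0_log_right0 c1 ltr01.
have e20 : 0 < D / 4 / `|mu_a| by rewrite !divr_gt0// normr_gt0; apply/eqP.
have [T2 H2] := cvg0_log_right0 c2 e20.
have e30 : 0 < D / 4 / (`|gamma| + 1) by rewrite !divr_gt0// ltr_wpDl.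
have [T3 H3] := expR_scale_small ltr01 e30.
have e40 : 0 < D / 4 / (`|k%:~R| + 1) by rewrite !divr_gt0// ltr_wpDl.
have [T4 H4] := expR_scale_small a0 e40.
have e50 : 0 < D / 8 by rewrite divr_gt0.
have [T5 H5] := expR_scale_small ltr01 e50.
exists sg, (Num.min (Num.min T1 T2) (Num.min (Num.min T3 0) (Num.min T4 T5))).
split => // t; rewrite !le_min.
move=> /andP[/andP[/H1 h1 /H2 h2] /andP[/andP[/H3 h3 t0] /andP[/H4 h4 /H5 h5]]].
have E := V_expansion_log t VE; have F := derive_V_expansion_log t V_C1 VE.
rewrite mulr1 in h3 h5.
rewrite -(ler_pM2l (expR_gt0 (t * alpha))) log_qE /log_p.
set A := expR (t * alpha) in E F h4 *; set r := expR t in E F h1 h2 h3 h5 *.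
have A0 : 0 < A by exact: expR_gt0.
have r0 : 0 < r by exact: expR_gt0.
have A1 : A <= 1 by rewrite -expR0 ler_expR mulr_le0_ge0// ltW.
rewrite [leLHS](_ : _ = - r * (A * V r) + 2 * r * A); last by ring.
rewrite [leRHS](_ : _ = - sg * k%:~R * A - sg * mu_a * (A * (r * derive1 V r)));
  last by ring.
rewrite E F.
set rho := r `^ alpha * rem r in h1 *.
set rho' := r `^ (alpha + 1) * derive1 rem r in h2 *.
have sg1 : `|sg| = 1 by case: sgE => ->; rewrite ?normrN normr1.
have b1 : - r * (gamma + rho) <= D / 4.
  apply: (le_trans (ler_norm _)); rewrite normrM normrN (gtr0_norm r0).
  apply: (@le_trans _ _ (r * (`|gamma| + 1))).
    by rewrite ler_pM2l// (le_trans (ler_normD _ _))// lerD2l.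
  by rewrite -ler_pdivlMr// ltr_wpDl.
have b2 : 2 * r * A <= D / 4.
  apply: (@le_trans _ _ (2 * r * 1)); last by lra.
  by rewrite ler_pM2l// mulr_gt0.
have b3 : sg * k%:~R * A <= D / 4.
  apply: (le_trans (ler_norm _)); rewrite !normrM sg1 mul1r (gtr0_norm A0).
  apply: (@le_trans _ _ ((`|k%:~R| + 1) * A)).
    by rewrite ler_pM2r// lerDl.
  by rewrite mulrC -ler_pdivlMr// ltr_wpDl.
have b4 : sg * mu_a * rho' <= D / 4.
  apply: (le_trans (ler_norm _)); rewrite normrM (normrM sg) sg1 mul1r.
  by rewrite mulrC -ler_pdivlMr ?normr_gt0//; apply/eqP.
have b5 : sg * mu_a * (gamma * alpha) = D by rewrite -mulrA.
rewrite (_ : sg * mu_a * (- (gamma * alpha) + rho') = sg * mu_a * rho' - D).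
  by lra.
by rewrite -b5; ring.
Qed.

End Asymptotics.

Theorem proposition3p9 (R : realType) (mu_a : R) (k : int) (V : R -> R)
    (gamma_oo alpha_oo gamma_0 alpha_0 : R) (R_Voo R_V0 : R -> R)
    (k_neq0 : k != 0)
    (V_C1 : C1_pos V)
    (V_incr : forall x y : R, 0 < x -> x < y -> V x < V y)
    (V_neg : forall x : R, 0 < x -> V x < 0)
    (V_infty : cond_Vinfty V gamma_oo alpha_oo R_Voo)
    (V_zero : cond_V0 mu_a k V gamma_0 alpha_0 R_V0) :
  exists lambda : nat -> R,
    (forall n, -1 < lambda n < 1 /\
               A0_eigenvalue (dirac_P mu_a k V) (lambda n)) /\
    lambda n @[n --> \oo] --> (1 : R).
Proof.
have p_gt0 t : 0 < log_p V t.
  by rewrite oppr_gt0 nmulr_llt0 ?expR_gt0// V_neg ?expR_gt0.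
have [sg [T0 [sgE qdom]]] := log_q_dominates V_C1 k_neq0 V_zero.
have ev e : 0 < e < 1 -> exists lambda, 1 - e <= lambda < 1 /\
    A0_eigenvalue (dirac_P mu_a k V) lambda.
  move=> e01.
  have [lambda [theta [m [/andP[l1 l2] sol zone0 [T1 zone1]]]]] :=
    connecting_angle (continuous_log_p V_C1)
      (continuous_log_q (mu_a := mu_a) (k := k) V_C1) p_gt0 sgE qdom
      (log_p_small V_infty) (log_p_dominates mu_a k V_C1 V_infty) e01.
  exists lambda; split; first by rewrite l1.
  apply: (@dirac_eigenvalue _ mu_a k V V_C1 lambda theta sg T0 T1) => //.
  - by rewrite l2 andbT; move: e01 => /andP[_]; lra.
  - move=> t /zone0 /andP[z1 z2].
    have -> : theta t = start_angle sg + (theta t - start_angle sg) by ring.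
    have [-> _] := cos_sin_double_start sgE (theta t - start_angle sg).
    rewrite mulrA (sg_sqr sgE) mul1r; apply: cos_ge0_pihalf.
    by rewrite -!two_pi4; apply/andP; split; lra.
  - move=> t /zone1[/andP[z1 z2] small]; split => //.
    have -> : theta t = m%:R * pi + (theta t - m%:R * pi) by ring.
    have [_ ->] := cos_sin_double_shift m (theta t - m%:R * pi).
    rewrite -oppr_ge0 -sinN; apply: sin_ge0_pi.
    by apply/andP; split; lra.
have /choice[lambda lP] : forall n : nat, exists lambda : R,
    1 - (n.+2%:R)^-1 <= lambda < 1 /\ A0_eigenvalue (dirac_P mu_a k V) lambda.
  by move=> n; apply: ev; rewrite invr_gt0 ltr0n/= invf_lt1 ?ltr0n// ltr1n.
exists lambda; split => [n|].
  have [/andP[l1 l2] e] := lP n; split => //; rewrite l2 andbT.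
  have i1 : (n.+2%:R)^-1 < 1 :> R by rewrite invf_lt1 ?ltr0n// ltr1n.
  by move: l1 i1; set i := _^-1; lra.
apply/cvgrPdist_le => e e0; near=> n.
have [/andP[l1 l2] _] := lP n; rewrite ger0_norm; last by lra.
have ie : (n.+2%:R)^-1 <= e.
  rewrite invf_ple ?posrE ?ltr0n//.
  apply: (@le_trans _ _ n%:R); last by rewrite ler_nat -addn2 leq_addr.
  by near: n; exact: nbhs_infty_ger.
by move: l1 ie; set i := _^-1; lra.
Unshelve. all: by end_near. Qed.
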